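(* Let $n\ge2$, $s\in(0,1)$, and let $\Omega\subset\mathbb{R}^n$ be a bounded Lipschitz domain. Suppose that $u\in C^1(\overline{\Omega})\cap\mathcal{L}^s(\mathbb{R}^n)$ is a weak subsolution of $$-\Delta u+(-\Delta)^su+c(x)u=g\ \text{ in }\Omega,\qquad u\le0\ \text{ on }\mathbb{R}^n\setminus\Omega,$$ where $c,g\in L^\infty(\Omega)$. Then there exist two constants $\delta=\delta(n,\|c\|_{L^\infty(\Omega)})>0$ and $\mathcal{K}=\mathcal{K}(n,\|c\|_{L^\infty(\Omega)})>0$ (depending only on the indicated quantities) such that whenever $|\Omega|\le\delta$, we have $$\|u^+\|_{L^\infty(\Omega)}\le\mathcal{K}\|g\|_{L^\infty(\Omega)}.$$
   Context: $u^+=\max\{u,0\}$; $|\Omega|$ is the Lebesgue measure of $\Omega$. $\mathcal{L}^s(\mathbb{R}^n)=\{u\in L^1_{\mathrm{loc}}(\mathbb{R}^n):\int_{\mathbb{R}^n}\frac{|u(y)|}{(1+|y|)^{n+2s}}dy<\infty\}$. $(-\Delta)^s u(x)=\mathrm{P.V.}\int_{\mathbb{R}^n}\frac{u(x)-u(y)}{|x-y|^{n+2s}}\,dy$ (no normalization constant). A function $u\in H^1_{\mathrm{loc}}(\Omega)\cap\mathcal{L}^s(\mathbb{R}^n)$ is a (weak) subsolution of $-\Delta u+(-\Delta)^su+c(x)u=g$ in $\Omega$ if $$\int_\Omega\nabla u\cdot\nabla\phi\,dx+\int_{\mathbb{R}^n}\int_{\mathbb{R}^n}\frac{(u(x)-u(y))(\phi(x)-\phi(y))}{|x-y|^{n+2s}}\,dy\,dx+\int_\Omega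 cu\phi\,dx\le\int_\Omega g\phi\,dx$$ for every nonnegative $\phi\in C^1_c(\Omega)$. *)

(* Defs.v *)
From HB Require Import structures.
From mathcomp Require Import all_boot all_order all_algebra.
From mathcomp Require Import all_classical all_reals all_analysis.

Set Implicit Arguments.
Unset Strict Implicit.
Unset Printing Implicit Defensive.

Import Order.TTheory GRing.Theory Num.Theory.
Import numFieldNormedType.Exports.

Local Open Scope classical_set_scope.
Local Open Scope ring_scope.

(* The sigma-algebra generated by the coordinates (as for n-tuples in
   MathComp-Analysis); over a realType it is the Borel sigma-algebra. *)
Section rV_measurable.
Context {d} {T : measurableType d} (n : nat).

Let coords : 'I_n -> 'rV[T]_n -> T := fun i x => x ord0 i.

Let rV_set0 : g_sigma_preimage coords set0.
Proof. exact: sigma_algebra0. Qed.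

Let rV_setC A : g_sigma_preimage coords A -> g_sigma_preimage coords (~` A).
Proof. exact: sigma_algebraC. Qed.

Let rV_bigcup (F : (set 'rV[T]_n)^nat) :
  (forall i, g_sigma_preimage coords (F i)) ->
  g_sigma_preimage coords (\bigcup_i (F i)).
Proof. exact: sigma_algebra_bigcup. Qed.

HB.instance Definition _ := @isMeasurable.Build (measure_tuple_display d)
  'rV[T]_n (g_sigma_preimage coords) rV_set0 rV_setC rV_bigcup.

End rV_measurable.

Lemma measurable_fun_rVP d d' (X : measurableType d) (T : measurableType d')
    (n : nat) (f : X -> 'rV[T]_n) :
  measurable_fun [set: X] f <->
  forall i, measurable_fun [set: X] (fun x => f x ord0 i).
Proof.
split=> [mf i _ A mA|mf].
- rewrite setTI; have -> : (fun x => f x ord0 i) @^-1` A =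
      setT `&` f @^-1` [set v : 'rV[T]_n | A (v ord0 i)] by rewrite setTI.
  apply: mf => //; apply: sub_sigma_algebra => /=.
  rewrite -bigcup_seq/=; exists i => /=; first by rewrite mem_index_enum.
  by exists A => //; rewrite setTI.
- move=> _ A mA; rewrite setTI.
  suff: g_sigma_preimage (fun i (v : 'rV[T]_n) => v ord0 i) `<=`
      [set B | measurable (f @^-1` B)] by exact.
  apply: smallest_sub.
    split => /=; first by rewrite preimage_set0.
    - by move=> B /= mB; rewrite setTD preimage_setC; exact: measurableC.
    - by move=> F mF; rewrite /= preimage_bigcup; exact: bigcup_measurable.
  rewrite -bigcup_seq => B [i _ [C mC <-]] /=.
  by rewrite setTI; have := mf i measurableT C mC; rewrite setTI.
Qed.

Section lebesgue_cons.
Context {R : realType} (n : nat).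
Local Open Scope ereal_scope.

Definition rV_cons (p : R * 'rV[R]_n) : 'rV[R]_n.+1 :=
  row_mx (p.1%:M : 'rV[R]_1) p.2.

Lemma rV_cons0 p : rV_cons p ord0 ord0 = p.1.
Proof. rewrite mxE; case: splitP => // j E; by rewrite (ord1 j) mxE eqxx. Qed.

Lemma rV_consS p j : rV_cons p ord0 (lift ord0 j) = p.2 ord0 j.
Proof.
rewrite mxE; case: splitP => [k /= jk|k /= /eqP].
  by have := ltn_ord k; rewrite -jk.
by rewrite eqSS => /eqP jk; congr (p.2 ord0 _); exact/val_inj.
Qed.

Lemma measurable_rV_cons : measurable_fun [set: R * 'rV[R]_n] rV_cons.
Proof.
apply/measurable_fun_rVP => i; case: (unliftP ord0 i) => [j ->|->].
  under eq_fun do rewrite rV_consS.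
  apply: (measurableT_comp (f := fun v : 'rV[R]_n => v ord0 j)) => //.
  by have /measurable_fun_rVP := @measurable_id _ 'rV[R]_n setT.
by under eq_fun do rewrite rV_cons0; exact: measurable_fst.
Qed.

Variable mu : {sigma_finite_measure set 'rV[R]_n -> \bar R}.

Definition lebesgue_cons : set 'rV[R]_n.+1 -> \bar R :=
  pushforward (@lebesgue_measure R \x mu) rV_cons.

Let lebesgue_cons0 : lebesgue_cons set0 = 0.
Proof. by rewrite /lebesgue_cons /pushforward preimage_set0 measure0. Qed.

Let lebesgue_cons_ge0 A : 0 <= lebesgue_cons A.
Proof. exact: (measure_ge0 (@lebesgue_measure R \x mu)). Qed.

Let measurable_preimage_cons A : measurable A -> measurable (rV_cons @^-1` A).
Proof. by move=> mA; rewrite -[X in measurable X]setTI; exact: measurable_rV_cons. Qed.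

Let lebesgue_cons_sigma_additive : semi_sigma_additive lebesgue_cons.
Proof.
move=> F mF tF mUF; rewrite /lebesgue_cons /pushforward preimage_bigcup.
apply: measure_semi_sigma_additive => [i||].
- exact: measurable_preimage_cons.
- apply/trivIsetP => /= i j _ _ ij; rewrite -preimage_setI.
  by move/trivIsetP : tF => /(_ _ _ _ _ ij) ->//; rewrite preimage_set0.
- by rewrite -preimage_bigcup; exact: measurable_preimage_cons.
Qed.

HB.instance Definition _ := isMeasure.Build _ _ _ lebesgue_cons
  lebesgue_cons0 lebesgue_cons_ge0 lebesgue_cons_sigma_additive.

Let lebesgue_cons_sigma_finite : sigma_finite setT lebesgue_cons.
Proof.
have /sigma_finiteP[F [TF ndF Foo]] := sigma_finiteT (@lebesgue_measure R).
have /sigma_finiteP[G [TG ndG Goo]] := sigma_finiteT mu.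
pose S k := [set v : 'rV[R]_n.+1 |
  F k (v ord0 ord0) /\ G k (\row_j v ord0 (lift ord0 j))].
have coord i : measurable_fun [set: 'rV[R]_n.+1] (fun v => v ord0 i).
  by have /measurable_fun_rVP := @measurable_id _ 'rV[R]_n.+1 setT.
have mtail : measurable_fun [set: 'rV[R]_n.+1]
    (fun v => \row_j v ord0 (lift ord0 j) : 'rV[R]_n).
  by apply/measurable_fun_rVP => j; under eq_fun do rewrite mxE; exact: coord.
exists S.
  rewrite predeqE => v; split => // _.
  have : setT (v ord0 ord0) by [].
  have : setT (\row_j v ord0 (lift ord0 j) : 'rV[R]_n) by [].
  rewrite TF TG => -[k _ Gk] [l _ Fl]; exists (maxn k l) => //; split.
  - by have /subsetPset := ndF _ _ (leq_maxr k l); exact.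
  - by have /subsetPset := ndG _ _ (leq_maxl k l); exact.
move=> k; have [mFk Fkoo] := Foo k; have [mGk Gkoo] := Goo k; split.
  rewrite -[S k]setTI; apply: measurableI => //.
  by apply: measurableI; rewrite -[X in measurable X]setTI;
    [exact: coord|exact: mtail].
rewrite /lebesgue_cons /pushforward (_ : _ @^-1` _ = F k `*` G k); last first.
  rewrite predeqE => p; rewrite /S /= rV_cons0.
  by rewrite (_ : \row_j _ = p.2)//; apply/rowP => j; rewrite mxE rV_consS.
by rewrite product_measure1E// lte_mul_pinfty// ge0_fin_numE.
Qed.

HB.instance Definition _ := Measure_isSigmaFinite.Build _ _ _ lebesgue_cons
  lebesgue_cons_sigma_finite.

End lebesgue_cons.

Fixpoint lebesgue_rV {R : realType} (n : nat) :
    {sigma_finite_measure set 'rV[R]_n -> \bar R} :=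
  if n is m.+1 then lebesgue_cons (lebesgue_rV m) else \d_(0 : 'rV[R]_0).

Lemma lebesgue_rV_box (R : realType) (n : nat) (A : 'I_n -> set R) :
  (forall i, measurable (A i)) ->
  lebesgue_rV n [set x : 'rV[R]_n | forall i, A i (x ord0 i)] =
  (\prod_(i < n) lebesgue_measure (A i))%E.
Proof.
elim: n A => [|n IHn] A mA.
  rewrite big_ord0 /= diracE mem_set//.
  by move=> [].
have mB : measurable [set x : 'rV[R]_n | forall i, A (lift ord0 i) (x ord0 i)].
  have -> : [set x : 'rV[R]_n | forall i, A (lift ord0 i) (x ord0 i)] =
      \bigcap_(i in [set: 'I_n]) [set x | A (lift ord0 i) (x ord0 i)].
    by apply/seteqP; split => x /= Ax i; [move=> _|]; exact: Ax.
  apply: fin_bigcap_measurable => // i _; rewrite -[X in measurable X]setTI.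
  have /measurable_fun_rVP := @measurable_id _ 'rV[R]_n setT.
  by apply => //; exact: mA.
rewrite big_ord_recl -IHn => [|i]; last exact: mA.
rewrite -product_measure1E//=; last exact: mA.
rewrite /lebesgue_cons /pushforward.
congr ((lebesgue_measure \x lebesgue_rV n)%E _).
apply/seteqP; split => -[a x] /=.
  move=> Ax; split => /=; first by have := Ax ord0; rewrite rV_cons0.
  by move=> i; have := Ax (lift ord0 i); rewrite rV_consS.
move=> [Aa Ax] i; case: (unliftP ord0 i) => [j ->|->].
  by rewrite rV_consS; exact: Ax.
by rewrite rV_cons0.
Qed.

Section weak_solutions.
Context {R : realType} {n : nat}.
Implicit Types (x y : 'rV[R]_n) (Omega K : set 'rV[R]_n) (u phi : 'rV[R]_n -> R).

Local Notation mu := (@lebesgue_rV R n).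

(* The library norm on ['rV[R]_n] is the sup norm. *)
Definition enorm x : R := Num.sqrt (\sum_i x ord0 i ^+ 2).

Definition dotv x y : R := \sum_i x ord0 i * y ord0 i.

Definition grad u x : 'rV[R]_n := \row_i 'D_(delta_mx ord0 i) u x.

(* [|| f ||_{L^oo(Omega)}], through the extension of [f] by zero. *)
Definition Linfty_norm Omega (f : 'rV[R]_n -> R) : \bar R :=
  ('N[mu]_+oo[(EFin \o f) \_ Omega])%E.

Definition Linfty Omega (f : 'rV[R]_n -> R) : Prop :=
  measurable_fun Omega f /\ (Linfty_norm Omega f < +oo)%E.

Definition L1loc Omega (f : 'rV[R]_n -> R) : Prop :=
  measurable_fun Omega f /\
  forall K, K `<=` Omega -> compact K ->
    (\int[mu]_(x in K) `|f x|%:E < +oo)%E.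

Definition L2loc Omega (f : 'rV[R]_n -> R) : Prop :=
  measurable_fun Omega f /\
  forall K, K `<=` Omega -> compact K ->
    (\int[mu]_(x in K) (f x ^+ 2)%:E < +oo)%E.

(* The space [\mathcal{L}^s(R^n)] of functions with an integrable tail. *)
Definition tail_space (s : R) u : Prop :=
  L1loc setT u /\
  (\int[mu]_y (`|u y| / (1 + enorm y) `^ (n%:R + 2 * s))%:E < +oo)%E.

(* [u] is C^1 in [Omega], and [u] and its gradient extend continuously to
   [closure Omega]; the values of the extension of [u] are those of [u]. *)
Definition C1_closure Omega u : Prop :=
  [/\ {within closure Omega, continuous u},
      forall x i, Omega x -> derivable u x (delta_mx ord0 i) &
      exists2 G : 'rV[R]_n -> 'rV[R]_n, {within closure Omega, continuous G} &
        forall x, Omega x -> G x = grad u x].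

(* Elements of C^1_c(Omega) are identified with their extensions by zero. *)
Definition C1c Omega phi : Prop :=
  [/\ forall x i, derivable phi x (delta_mx ord0 i),
      continuous (grad phi),
      compact (closure [set x | phi x != 0]) &
      closure [set x | phi x != 0] `<=` Omega].

Definition weak_gradient Omega u (Du : 'rV[R]_n -> 'rV[R]_n) : Prop :=
  forall i : 'I_n,
    L1loc Omega (fun x => Du x ord0 i) /\
    forall phi, C1c Omega phi ->
      \int[mu]_(x in Omega) (u x * grad phi x ord0 i) =
      - \int[mu]_(x in Omega) (Du x ord0 i * phi x).

Definition H1loc Omega u : Prop :=
  L2loc Omega u /\
  exists2 Du, weak_gradient Omega u Du &
    forall i : 'I_n, L2loc Omega (fun x => Du x ord0 i).

(* Weak subsolution of [- Laplacian u + (- Laplacian)^s u + c u = g].  As the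
   weak gradient is unique up to a null set, quantifying over all its
   representatives [Du] does not depend on a choice. *)
Definition weak_subsolution (s : R) Omega (c g u : 'rV[R]_n -> R) : Prop :=
  [/\ H1loc Omega u, tail_space s u &
   forall Du, weak_gradient Omega u Du ->
   forall phi, C1c Omega phi -> (forall x, 0 <= phi x) ->
     \int[mu]_(x in Omega) dotv (Du x) (grad phi x)
     + \int[mu]_x (\int[mu]_y
         ((u x - u y) * (phi x - phi y) / enorm (x - y) `^ (n%:R + 2 * s)))
     + \int[mu]_(x in Omega) (c x * u x * phi x)
     <= \int[mu]_(x in Omega) (g x * phi x)].

(* Near each boundary point, in suitable orthonormal coordinates [z = y *m Q],
   [Omega] is the strict epigraph [gamma z' < z_j] of a Lipschitz function of
   the remaining coordinates [z' = col' j z]. *)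
Definition lipschitz_boundary Omega : Prop :=
  forall x, (closure Omega `\` Omega°) x ->
  exists (r : R) (Q : 'M[R]_n) (j : 'I_n) (gamma : 'rV[R]_n.-1 -> R) (L : R),
    [/\ 0 < r, Q *m Q^T = 1%:M, L.-lipschitz gamma &
     forall y, enorm (y - x) < r ->
       (Omega y <-> gamma (col' j (y *m Q)) < (y *m Q) ord0 j)].

Definition bounded_lipschitz_domain Omega : Prop :=
  [/\ open Omega, connected Omega, Omega !=set0, bounded_set Omega &
      lipschitz_boundary Omega].

End weak_solutions.

(* Main.v *)
(** Testing with [phi = F o u], where [F(t) = ((t - k)^+)^3] is nondecreasing
    and of class C^1, makes the nonlocal term nonnegative pointwise, so it can
    be dropped; as [u <= 0] outside [Omega], such a [phi] automatically lies in
    C^1_c(Omega).  With [P = (u - k)^+], [A >= ||g|| + ||c|| sup u^+] and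
    [|D (P^2)|^2 = 4 P^2 |Du|^2] this leaves [int |D (P^2)|^2 <= 4/3 A int P^3].
    A Faber-Krahn inequality [int w^2 <= 2 n r^2 int |Dw|^2], valid as soon as
    the cube of half side [r] has at least twice the measure of [{w <> 0}],
    turns this into [int P^4 <= D int P^3] with [D = 3 n r^2 A], whence
    [int P^4 <= 16 D^4 |{u > k}|] and [|{u > k + 4 D}| <= |{u > k}| / 16].
    Iterating with geometrically decreasing radii, the levels converge and
    [sup u^+ <= k + C(n) r^2 A] where [r^n ~ |Omega|]; for small [|Omega|] the
    part of [A] that involves [sup u^+] is absorbed by the left-hand side. *)
Require Import Defs.
From mathcomp Require Import all_boot all_order all_algebra.
From mathcomp Require Import all_classical all_reals all_analysis.
From mathcomp Require Import measurable_realfun ess_sup_inf ring lra.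

Set Implicit Arguments.
Unset Strict Implicit.
Unset Printing Implicit Defensive.

Import Order.TTheory GRing.Theory Num.Theory.
Import numFieldNormedType.Exports.

Local Open Scope classical_set_scope.
Local Open Scope ring_scope.

(** * Measurability and translation invariance *)

Section lebesgue_rV_theory.
Context {R : realType}.

Lemma measurable_coord n (i : 'I_n) :
  measurable_fun [set: 'rV[R]_n] (fun x => x ord0 i).
Proof. by have /measurable_fun_rVP := @measurable_id _ 'rV[R]_n setT. Qed.

Lemma measurable_box n (A : 'I_n -> set R) : (forall i, measurable (A i)) ->
  measurable [set x : 'rV[R]_n | forall i, A i (x ord0 i)].
Proof.
move=> mA.
have -> : [set x : 'rV[R]_n | forall i, A i (x ord0 i)] =
    \bigcap_(i in [set: 'I_n]) [set x | A i (x ord0 i)].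
  by apply/seteqP; split => x /= Ax i; [move=> _|]; exact: Ax.
apply: fin_bigcap_measurable => // i _; rewrite -[X in measurable X]setTI.
exact: measurable_coord.
Qed.

Lemma rV_norm_lt n (x : 'rV[R]_n) (e : R) : 0 < e ->
  (forall i, `|x ord0 i| < e) -> `|x| < e.
Proof.
move=> e0 xe; rewrite [ltLHS]/Num.norm/= mx_normrE; apply/bigmax_ltP;
  split => //.
by move=> -[a i] _ /=; rewrite (ord1 a).
Qed.

Lemma rV_coord_le n (x : 'rV[R]_n) i : `|x ord0 i| <= `|x|.
Proof.
rewrite [leRHS]/Num.norm/= mx_normrE; apply/bigmax_geP; right => /=.
by exists (ord0, i).
Qed.

Lemma rV_norm_le n (x : 'rV[R]_n) (e : R) : 0 <= e ->
  (forall i, `|x ord0 i| <= e) -> `|x| <= e.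
Proof.
move=> e0 xe; rewrite [leLHS]/Num.norm/= mx_normrE; apply/bigmax_leP;
  split => //.
by move=> -[a i] _ /=; rewrite (ord1 a).
Qed.

(** The sigma-algebra is generated by the coordinates, so openness is converted by hand: an open set
    is the countable union of the cubes with rational centre and half side [1 / (k + 1)] that it
    contains. *)
Lemma open_measurable_rV n (U : set 'rV[R]_n) : open U -> measurable U.
Proof.
move=> oU.
pose B (q : 'rV[rat]_n) (k : nat) := [set x : 'rV[R]_n |
  forall i, ball (ratr (q ord0 i) : R) (k.+1%:R^-1) (x ord0 i)].
have mB q k : measurable (B q k).
  by apply: (@measurable_box _ (fun i =>
    ball (ratr (q ord0 i) : R) (k.+1%:R^-1))) => i; exact: measurable_ball.
(* The pairs [(q, k)] are enumerated through [pickle]; an index that decodes to no pair, or to a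
   cube not inside [U], contributes [set0]. *)
pose C (m : nat) : set 'rV[R]_n :=
  if @unpickle ('rV[rat]_n * nat)%type m is Some qk then
    (if pselect (B qk.1 qk.2 `<=` U) then B qk.1 qk.2 else set0) else set0.
have mC m : measurable (C m).
  by rewrite /C; case: unpickle => [[q k]|] //=; case: pselect => //= _;
    exact: mB.
suff -> : U = \bigcup_m C m by exact: bigcup_measurable.
apply/seteqP; split => [x Ux|x [m _]]; last first.
  by rewrite /C; case: unpickle => [[q k]|] //=; case: pselect => //= + Bx;
    apply.
have /nbhs_ballP[e /= e0 xeU] : nbhs x U by apply: open_nbhs_nbhs; split.
have [k ke] : exists k : nat, k.+1%:R^-1 < e / 2.
  have e20 : 0 < e / 2 by rewrite divr_gt0.
  have [k _ ke] := near_infty_natSinv_lt (PosNum e20).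
  by exists k; exact: (ke k (leqnn k)).
have hq (i : 'I_n) : exists q : rat, ball (ratr q : R) (k.+1%:R^-1) (x ord0 i).
  have [|q] := rat_in_itvoo (x := x ord0 i - k.+1%:R^-1)
    (y := x ord0 i + k.+1%:R^-1).
    by rewrite ltrBlDr -addrA ltrDl addr_gt0// invr_gt0.
  rewrite in_itv/= => /andP[q1 q2]; exists q; rewrite /ball/=.
  by rewrite ltr_norml ltrBrDr ltrBlDr [- _ + _]addrC [X in _ && (_ < X)]addrC
    q1 q2.
have [f fP] := choice hq.
pose q : 'rV[rat]_n := \row_i f i.
have xB : B q k x by move=> i; rewrite mxE; exact: fP.
exists (pickle (q, k)) => //; rewrite /C pickleK /=; case: pselect => //= -[].
move=> y By; apply: xeU; rewrite -ball_normE/=.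
apply: rV_norm_lt => // i; rewrite !mxE.
apply: le_lt_trans (ler_distD (ratr (q ord0 i)) _ _) _.
rewrite [e]splitr ltrD//; last exact: lt_trans (By i) ke.
by rewrite distrC; exact: lt_trans (xB i) ke.
Qed.

Lemma closed_measurable_rV n (U : set 'rV[R]_n) : closed U -> measurable U.
Proof. by move/closed_openC/open_measurable_rV/measurableC; rewrite setCK. Qed.

Lemma continuous_measurable_rV n (f : 'rV[R]_n -> R) :
  continuous f -> measurable_fun setT f.
Proof.
move=> /continuousP cf; apply: (measurability _ (RGenOpens.measurableE R)).
move=> _ [_ [a [b ->] <-]]; rewrite setTI; apply: open_measurable_rV.
exact/cf/interval_open.
Qed.

Lemma measurable_addrV n (h : 'rV[R]_n) :
  measurable_fun setT (fun x : 'rV[R]_n => x + h).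
Proof.
apply/measurable_fun_rVP => i; under eq_fun do rewrite mxE.
by apply: measurable_funD => //; exact: measurable_coord.
Qed.

(** Lebesgue measure is determined by its values on half-open intervals, whose length a translation
    preserves. *)
Lemma lebesgue_measure_translate (h : R) (A : set (measurableTypeR R)) :
  measurable A -> lebesgue_measure ((fun x => x + h) @^-1` A) =
    lebesgue_measure A.
Proof.
move=> mA.
have mh : measurable_fun setT (fun x : measurableTypeR R =>
  x + h : measurableTypeR R).
  by apply: measurable_funD.
apply/esym/(@lebesgue_measure_unique _
  (pushforward lebesgue_measure
  (fun x : measurableTypeR R => x + h : measurableTypeR R))) => //.
move=> _ [[a b]] _ <-; rewrite /pushforward /=.
transitivity (lebesgue_measure `]a - h, b - h]%classic); last first.
  congr lebesgue_measure; apply/seteqP; split => x /=; rewrite !in_itv/=;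
  by rewrite ltrBlDr lerBrDr.
rewrite !lebesgue_measure_itv/= !lte_fin ltrD2r -!EFinB.
by rewrite opprB addrA subrK.
Qed.

(** Induction on the dimension: [rV_cons] intertwines the translation by [h] with a translation [T]
    of the product, and the image of the product measure under [T] agrees with it on rectangles. *)
Lemma lebesgue_rV_translate n (h : 'rV[R]_n) (A : set 'rV[R]_n) :
  measurable A -> lebesgue_rV n ((fun x => x + h) @^-1` A) = lebesgue_rV n A.
Proof.
elim: n h A => [|n IH] h A mA.
  congr (lebesgue_rV 0 _); apply/seteqP; split => x /=;
  by rewrite (_ : x + h = x)//; apply/rowP => -[].
pose h' : 'rV[R]_n := \row_j h ord0 (lift ord0 j).
pose T (p : measurableTypeR R * 'rV[R]_n) : measurableTypeR R * 'rV[R]_n :=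
  (p.1 + h ord0 ord0, p.2 + h').
have mT : measurable_fun setT T.
  apply: measurable_fun_pair; first exact: measurable_funD.
  by apply: (measurableT_comp (measurable_addrV h')).
rewrite /= /lebesgue_cons /pushforward.
have -> : @rV_cons R n @^-1` ((fun x => x + h) @^-1` A) =
  T @^-1` (@rV_cons R n @^-1` A).
  suff E p : rV_cons p + h = rV_cons (T p) :> 'rV[R]_n.+1.
    by apply/seteqP; split => p /=; rewrite E.
  apply/rowP => i; rewrite mxE; case: (unliftP ord0 i) => [j ->|->].
    by rewrite !rV_consS /= !mxE.
  by rewrite !rV_cons0.
have mcA : measurable (@rV_cons R n @^-1` A).
  by rewrite -[X in measurable X]setTI; exact: measurable_rV_cons.
apply/esym/(product_measure_unique
  (m' := pushforward (lebesgue_measure \x lebesgue_rV n)%E T)) => //.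
move=> C D mC mD; rewrite /pushforward.
transitivity ((lebesgue_measure \x lebesgue_rV n)%E
  (((fun x => x + h ord0 ord0) @^-1` C) `*` ((fun x => x + h') @^-1` D))) => //.
have mh : measurable_fun setT (fun x : measurableTypeR R =>
  x + h ord0 ord0 : measurableTypeR R).
  exact: measurable_funD.
have mC' : measurable ((fun x : measurableTypeR R =>
  x + h ord0 ord0 : measurableTypeR R) @^-1` C).
  by rewrite -[X in measurable X]setTI; exact: mh.
have mD' : measurable ((fun x => x + h') @^-1` D).
  by rewrite -[X in measurable X]setTI; exact: measurable_addrV.
rewrite product_measure1E// IH//; congr (_ * _)%E.
exact: lebesgue_measure_translate.
Qed.

Local Open Scope ereal_scope.
Lemma ge0_integral_translate n (h : 'rV[R]_n) (f : 'rV[R]_n -> \bar R) :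
  measurable_fun setT f -> (forall x, 0 <= f x) ->
  \int[lebesgue_rV n]_x f (x + h)%R = \int[lebesgue_rV n]_x f x.
Proof.
move=> mf f0; rewrite -[LHS](ge0_integral_pushforward (measurable_addrV h)
  (lebesgue_rV n) measurableT mf) //.
apply: eq_measure_integral; first exact: measurable_addrV.
by move=> mh A mA _; exact: lebesgue_rV_translate.
Qed.

Lemma integral_translate n (h : 'rV[R]_n) (f : 'rV[R]_n -> \bar R) :
  measurable_fun setT f ->
  \int[lebesgue_rV n]_x f (x + h)%R = \int[lebesgue_rV n]_x f x.
Proof.
move=> mf; rewrite integralE [RHS]integralE.
rewrite -(ge0_integral_translate h (measurable_funepos mf)) //.
rewrite -(ge0_integral_translate h (measurable_funeneg mf)) //.
by congr (_ - _); apply: eq_integral => x _; rewrite ?funeposE ?funenegE.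
Qed.

Lemma lebesgue_rV_bounded n (A : set 'rV[R]_n) (r : R) :
  (forall x, A x -> `|x| <= r)%R -> measurable A -> lebesgue_rV n A < +oo.
Proof.
move=> Ar mA.
apply: (@le_lt_trans _ _ (lebesgue_rV n
  [set x | forall i, `[(- r)%R, r]%classic (x ord0 i)])).
  apply: le_measure; rewrite ?inE//; first exact: (@measurable_box _ (fun=> _)).
  move=> x /Ar xr i; rewrite /= in_itv/= -ler_norml.
  exact: le_trans (rV_coord_le _ _) xr.
rewrite (@lebesgue_rV_box _ _ (fun=> _))//.
apply: (@lt_le_trans _ _ +oo) => //;
  suff : \prod_(i < n) lebesgue_measure `[(- r)%R, r]%classic \is a fin_num by
  rewrite ltey_eq => ->.
rewrite prode_fin_num// => i _.
by rewrite lebesgue_measure_itv/=; case: ifPn.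
Qed.

End lebesgue_rV_theory.

(** * Compactly supported C^1 functions *)

Section C1c_theory.
Context {R : realType} {n : nat}.
Implicit Types (x y h : 'rV[R]_n) (w : 'rV[R]_n -> R) (i : 'I_n).

Local Notation mu := (@lebesgue_rV R n).
Local Notation e_ i := (delta_mx (ord0 : 'I_1) i : 'rV[R]_n).

(** Partial derivatives become derivatives in one real variable along coordinate lines, where the
    mean value theorem is available. *)
Lemma is_derive_line w i x (t : R) : derivable w (x + t *: e_ i) (e_ i) ->
  is_derive t 1 (fun s : R => w (x + s *: e_ i))
    (grad w (x + t *: e_ i) ord0 i).
Proof.
move=> dw; rewrite mxE.
have E : (fun h : R => h^-1 *:
  (((fun s : R => w (x + s *: e_ i)) \o shift t) (h *: 1) - w (x + t *: e_ i)))
   = (fun h : R => h^-1 *: ((w \o shift (x + t *: e_ i)) (h *: e_ i) - w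
     (x + t *: e_ i))).
  apply/funext => h /=; congr (_ *: (w _ - _)).
  by rewrite [h%:A]mulr1 scalerDl addrCA.
apply: DeriveDef; first by rewrite /derivable E.
by rewrite /derive E.
Qed.

Lemma derivable_lipschitz_coord w i (C : R) x (t : R) :
  (forall y, derivable w y (e_ i)) -> (forall y, `|grad w y ord0 i| <= C) ->
  `|w (x + t *: e_ i) - w x| <= C * `|t|.
Proof.
move=> dw gC.
pose f (s : R) := w (x + s *: e_ i).
have df (s : R) : is_derive s 1 f (grad w (x + s *: e_ i) ord0 i).
  exact: is_derive_line.
have cf (a b : R) : {within `[a, b], continuous f}.
  apply: derivable_within_continuous => s _.
  by have := df s => -[].
have f0 : w x = f 0 by rewrite /f scale0r addr0.
rewrite -/(f t) f0.
have [t0|t0] := leP 0 t.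
  have [c _ ->] := MVT_segment t0 (fun s _ => df s) (cf _ _).
  by rewrite subr0 normrM ler_wpM2r.
have [c _] := MVT_segment (ltW t0) (fun s _ => df s) (cf _ _).
by rewrite distrC => ->; rewrite sub0r normrM normrN ler_wpM2r.
Qed.

(** The corners of the staircase path from 0 to [h] that changes one coordinate at a time. *)
Definition row_prefix h (k : nat) : 'rV[R]_n :=
  \row_j (if (j < k)%N then h ord0 j else 0).

Lemma row_prefixS h i :
  row_prefix h i.+1 = row_prefix h i + h ord0 i *: e_ i.
Proof.
apply/rowP => j; rewrite !mxE eqxx /= ltnS leq_eqVlt -(inj_eq val_inj)/=.
by case: ltngtP => //= [_|_|/val_inj ->]; rewrite ?mulr0 ?addr0 ?mulr1 ?add0r.
Qed.

Lemma telescope_row_prefix w x h :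
  w (x + h) - w x =
  \sum_(i < n) (w (x + row_prefix h i + h ord0 i *: e_ i) - w
    (x + row_prefix h i)).
Proof.
have hn : row_prefix h n = h by apply/rowP => j; rewrite mxE ltn_ord.
have h0 : row_prefix h 0 = 0 by apply/rowP => j; rewrite !mxE.
have := @telescope_sumr _ 0 n (fun k => w (x + row_prefix h k)) (leq0n n).
rewrite big_mkord hn h0 addr0 => <-.
by apply: eq_bigr => i _; rewrite row_prefixS addrA.
Qed.

(** Only partial derivatives are assumed to exist, so the increment is split along the staircase;
    each of its [n] segments contributes at most [C] times the sup norm of [h]. *)
Lemma derivable_lipschitz w (C : R) x h :
  (forall y i, derivable w y (e_ i)) -> (forall y i, `|grad w y ord0 i| <= C) ->
  `|w (x + h) - w x| <= n%:R * C * `|h|.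
Proof.
move=> dw gC; rewrite telescope_row_prefix.
apply: le_trans (ler_norm_sum _ _ _) _.
apply: (@le_trans _ _ (\sum_(i < n) C * `|h|)); last first.
  by rewrite sumr_const card_ord -[X in X <= _]mulr_natl mulrA.
apply: ler_sum => i _.
apply: le_trans (derivable_lipschitz_coord _ _ (dw ^~ i) (gC ^~ i)) _.
rewrite ler_wpM2l ?rV_coord_le//.
exact: le_trans (normr_ge0 _) (gC x i).
Qed.

Lemma grad_near0 w x : (\near x, w x = 0) -> grad w x = 0.
Proof.
move=> wx0; apply/rowP => i; rewrite !mxE.
have wc : \forall y \near x, w y = cst 0 y by [].
by rewrite (near_eq_derive _ wc) derive_cst.
Qed.

Lemma closure_support_near0 w x : ~ closure [set y | w y != 0] x ->
  \forall y \near x, w y = 0.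
Proof.
move=> xK; have : nbhs x (~` closure [set y | w y != 0]).
  by apply: open_nbhs_nbhs; split=> //; exact/closed_openC/closed_closure.
apply: filterS => y /= yK; apply/eqP/negPn/negP => wy.
by apply: yK; exact: subset_closure.
Qed.

Section C1c_fun.
Variables (Omega : set 'rV[R]_n) (w : 'rV[R]_n -> R).
Hypothesis C1w : C1c Omega w.

Lemma C1c_derivable x i : derivable w x (e_ i).
Proof. by case: C1w. Qed.

Lemma C1c_support_bounded : exists2 r :
  R, 0 < r & forall x, ~ closure [set y | w y != 0] x \/ `|x| <= r.
Proof.
have [_ _ cK _] := C1w.
have [r [_ rK]] := compact_bounded cK.
exists (`|r| + 1); first by rewrite ltr_wpDl.
move=> x; have [Kx|] := pselect (closure [set y | w y != 0] x); last by left.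
by right; apply: rK => //; rewrite (le_lt_trans (ler_norm _))// ltrDl.
Qed.

Lemma C1c_supp_radius : exists2 r : R, 0 < r &
  forall x, r < `|x| -> w x = 0 /\ grad w x = 0.
Proof.
have [r r0 rK] := C1c_support_bounded; exists r => // x rx.
have [xK|] := rK x; last by rewrite leNgt rx.
split; last exact/grad_near0/closure_support_near0.
exact: nbhs_singleton (closure_support_near0 xK).
Qed.

Lemma C1c_grad_bounded : exists2 C :
  R, 0 < C & forall x i, `|grad w x ord0 i| <= C.
Proof.
have [_ cg cK _] := C1w.
have cG : compact (grad w @` closure [set y | w y != 0]).
  by apply: continuous_compact cK; exact: continuous_subspaceT.
have [r [_ rK]] := compact_bounded cG.
exists (`|r| + 1); first by rewrite ltr_wpDl.
move=> x i; apply: le_trans (rV_coord_le _ _) _.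
have [Kx|xK] := pselect (closure [set y | w y != 0] x).
  apply: rK; last by exists x.
  by rewrite (le_lt_trans (ler_norm _))// ltrDl.
by rewrite (grad_near0 (closure_support_near0 xK)) normr0 addr_ge0.
Qed.

(** Continuity of [w] itself is not a clause of [C1c]; it comes from the Lipschitz bound given by
    the bounded gradient. *)
Lemma C1c_continuous : continuous w.
Proof.
have [C C0 gC] := C1c_grad_bounded.
move=> x; apply/(@cvgrPdist_le _ _ _ _ (nbhs_filter x)) => e e0.
(* Adding 1 keeps the constant positive even for [n = 0]. *)
have c0 : 0 < n%:R * C + 1 by rewrite ltr_wpDl// mulr_ge0// ltW.
near=> y.
have -> : y = x + (y - x) by rewrite addrC subrK.
rewrite distrC.
apply: le_trans (derivable_lipschitz _ _ C1c_derivable gC) _.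
apply: (@le_trans _ _ ((n%:R * C + 1) * `|y - x|)).
  by rewrite ler_wpM2r// lerDl.
rewrite mulrC -ler_pdivlMr// distrC.
near: y; apply/nbhs_ballP; exists (e / (n%:R * C + 1));
  first by rewrite /= divr_gt0.
by move=> z; rewrite -ball_normE/= => /ltW.
Unshelve. all: by end_near. Qed.

Lemma C1c_measurable : measurable_fun setT w.
Proof. exact: (continuous_measurable_rV C1c_continuous). Qed.

Lemma C1c_grad_continuous i : continuous (fun x => grad w x ord0 i).
Proof.
have [_ cg _ _] := C1w; move=> x.
apply: (@continuous_comp _ _ _ (grad w) (fun y : 'rV[R]_n => y ord0 i));
  first exact: cg.
exact: coord_continuous.
Qed.

Lemma C1c_grad_measurable i : measurable_fun setT (fun x => grad w x ord0 i).
Proof. exact: (continuous_measurable_rV (@C1c_grad_continuous i)). Qed.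

End C1c_fun.
End C1c_theory.

(** * Faber-Krahn inequality *)

Section faber_krahn.
Context {R : realType} {n : nat}.
Implicit Types (x y h : 'rV[R]_n) (f w : 'rV[R]_n -> R) (i : 'I_n).

Local Notation mu := (@lebesgue_rV R n).
Local Notation e_ i := (delta_mx (ord0 : 'I_1) i : 'rV[R]_n).

Definition cube (r : R) : set 'rV[R]_n :=
  [set x | forall i, `[(- r), r]%classic (x ord0 i)].

Lemma measurable_cube r : measurable (cube r).
Proof. exact: (@measurable_box _ _ (fun=> `[(- r), r]%classic)). Qed.

Lemma cubeE r x : 0 <= r -> cube r x <-> `|x| <= r.
Proof.
move=> r0; split=> [rx|xr i]; last first.
  by rewrite /= in_itv/= -ler_norml; exact: le_trans (rV_coord_le _ _) xr.
by apply: rV_norm_le => // i; have := rx i; rewrite /= in_itv/= -ler_norml.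
Qed.

Lemma lebesgue_cube (r : R) : 0 <= r -> mu (cube r) = ((2 * r) ^+ n)%:E.
Proof.
move=> r0; rewrite (@lebesgue_rV_box _ _ (fun=> _))//.
under eq_bigr do rewrite lebesgue_measure_itv/= lte_fin.
have -> : (if - r < r then (r%:E - (- r)%:E)%E else 0%E) = (2 * r)%:E.
  case: ifPn => [_|]; first by rewrite -EFinB opprK mulrDl !mul1r.
  rewrite -leNgt => rr; congr (_%:E); lra.
by rewrite prodEFin prodr_const card_ord.
Qed.

Lemma integrable_bounded f (r C : R) : measurable_fun setT f ->
  (forall x, `|f x| <= C) -> (forall x, r < `|x| -> f x = 0) ->
  mu.-integrable setT (EFin \o f).
Proof.
move=> mf fC fr.
(* The radius [r] may be negative, whereas [cubeE] needs a nonnegative half side. *)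
have r0 : 0 <= Num.max r 0 by rewrite le_max lexx orbT.
have mB := measurable_cube (Num.max r 0).
suff: mu.-integrable (cube (Num.max r 0)) (EFin \o f).
  move/(integrable_mkcond _ mB); apply: eq_integrable => // x _.
  rewrite /patch; case: ifPn => // /negP; rewrite inE cubeE// => xr.
  by rewrite /= fr// (le_lt_trans _ (_ : Num.max r 0 < _)) ?le_max ?lexx//
    ltNge; apply/negP.
apply: measurable_bounded_integrable => //.
- apply: (@lebesgue_rV_bounded _ _ _ (Num.max r 0)) => // x /cubeE; exact.
- exact: measurable_funTS.
- exists C; split; first exact: num_real.
  by move=> y Cy x _; exact: le_trans (fC x) (ltW Cy).
Qed.

(** Dominated convergence, the majorant being [C] times the indicator of a cube outside which every
    [f_ k] vanishes. *)
Lemma bounded_cvg_integral (f_ : nat -> 'rV[R]_n -> R) f (r C : R) :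
  (forall k, measurable_fun setT (f_ k)) -> measurable_fun setT f ->
  (forall x, f_ ^~ x @ \oo --> f x) ->
  (forall k x, `|f_ k x| <= C) -> (forall k x, r < `|x| -> f_ k x = 0) ->
  ((\int[mu]_x (f_ k x)%:E)%E @[k --> \oo] --> (\int[mu]_x (f x)%:E)%E).
Proof.
move=> mf_ mf ff fC fr.
have r0 : 0 <= Num.max r 0 by rewrite le_max lexx orbT.
have C0 : 0 <= C by exact: le_trans (normr_ge0 _) (fC 0 0).
pose g x := C * \1_(cube (Num.max r 0)) x.
have mg : measurable_fun setT g.
  apply: measurable_funM => //; apply: measurable_indic; exact: measurable_cube.
have [] := @dominated_convergence _ _ _ mu setT measurableT
  (fun k x => (f_ k x)%:E)
  (EFin \o f) (EFin \o g) _ _ _ _ _ => //.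
- by move=> k; apply/measurable_EFinP; exact: mf_.
- exact/measurable_EFinP.
- by apply: aeW => x _; apply: cvg_EFin; [near=> k|exact: ff].
- apply: (@integrable_bounded g (Num.max r 0) C) => // x.
    rewrite /g indicE normrM (ger0_norm C0); case: (_ \in _);
      first by rewrite normr1 mulr1.
    by rewrite normr0 mulr0.
  move=> xr; rewrite /g indicE memNset ?mulr0// => /cubeE => /(_ r0).
  by rewrite leNgt xr.
- apply: aeW => x k _; rewrite /= lee_fin /g indicE.
  case: (boolP (x \in _)) => [_|]; first by rewrite mulr1.
  move/negP; rewrite inE cubeE// => xr.
  rewrite fr ?normr0 ?mulr0// (le_lt_trans _ (_ : Num.max r 0 < _)) ?le_max
    ?lexx//.
  by rewrite ltNge; apply/negP.
Unshelve. all: by end_near. Qed.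

Lemma sume_const_ord (m : nat) (x : \bar R) :
  (\sum_(j < m) x = m%:R%:E * x)%E.
Proof.
elim: m => [|m IH]; first by rewrite big_ord0 mul0e.
by rewrite big_ord_recr/= IH -natr1 EFinD ge0_muleDl ?lee_fin// mul1e.
Qed.

Lemma sqr_sum_le (m : nat) (a : 'I_m -> R) :
  (\sum_j a j) ^+ 2 <= m%:R * \sum_j a j ^+ 2.
Proof.
elim: m a => [|m IH] a; first by rewrite !big_ord0 mulr0 expr0n.
rewrite !big_ord_recr/=; set S := \sum_j _; set T := \sum_j _; set b := a _.
have := IH (fun j => a (widen_ord (leqnSn m) j)); rewrite -/S -/T.
case: (posnP m) => [m0|m0] ST.
  have S0 : S = 0.
    by rewrite /S big1// => -[j jm]; exfalso; move: jm; rewrite m0.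
  have T0 : 0 <= T by rewrite /T; apply: sumr_ge0 => j _; exact: sqr_ge0.
  by rewrite S0 m0 add0r mul1r lerDr.
have mR : 0 < m%:R :> R by rewrite ltr0n.
(* After multiplication by [m], the claim [(S + b)^2 <= (m + 1) (T + b^2)] is the sum of
   [S^2 <= m T], taken [m + 1] times, and [0 <= (S - m b)^2]. *)
rewrite -natr1 -(ler_pM2l mR).
have : 0 <= (S - m%:R * b) ^+ 2 by exact: sqr_ge0.
set M : R := m%:R in mR ST *.
have := ler_wpM2l (ltW mR) ST.
nra.
Qed.

(** * Difference quotients and translation estimates *)

Section C1c_integrals.
Variables (Omega : set 'rV[R]_n) (w : 'rV[R]_n -> R).
Hypothesis C1w : C1c Omega w.

Definition diffq i (t : R) x := t^-1 * (w (x + t *: e_ i) - w x).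

(** The steps [t / (k + 1)] are those obtained by cutting a segment of length [t] into [k + 1] equal
    pieces. *)
Lemma diffq_cvg i (t : R) x : t != 0 ->
  diffq i (t * harmonic k) x @[k --> \oo] --> grad w x ord0 i.
Proof.
move=> t0; rewrite mxE.
have := @C1c_derivable _ _ _ _ C1w x i.
move/cvg_ex => [l dl]; have -> : 'D_(e_ i) w x = l by exact: cvg_lim dl.
move/cvgr_dnbhsP : dl => /(_ (fun k => t * harmonic k)) dl.
rewrite (_ : (fun k => diffq i (t * harmonic k) x) =
  (fun k => (t * harmonic k)^-1 *:
   ((w \o shift x) ((t * harmonic k) *: e_ i) - w x))).
  apply: dl; split.
    by move=> k; rewrite mulf_neq0// gt_eqF// harmonic_gt0.
  by rewrite -[X in _ --> X](mulr0 t); apply: cvgMr; exact: cvg_harmonic.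
by apply/funext => k; rewrite /diffq /= [_ + x]addrC.
Qed.

Lemma diffq_bounded : exists2 C :
  R, 0 < C & forall i (t : R) x, `|diffq i t x| <= C.
Proof.
have [C C0 gC] := C1c_grad_bounded C1w; exists C => // i t x.
(* The inverse of 0 is 0, so the quotient with step 0 vanishes. *)
have [->|t0] := eqVneq t 0; first by rewrite /diffq invr0 mul0r normr0 ltW.
rewrite /diffq normrM normfV mulrC ler_pdivrMr ?normr_gt0//.
apply: derivable_lipschitz_coord => y; last exact: gC.
exact: C1c_derivable C1w y i.
Qed.

(** Dominated convergence asks for one radius valid for all steps up to [T]: the radius of the
    support of [w] is enlarged by [T]. *)
Lemma diffq_supp (T : R) : 0 <= T ->
  exists r : R, forall i (t : R) x, `|t| <= T -> r < `|x| -> diffq i t x = 0.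
Proof.
move=> T0; have [r r0 wr] := C1c_supp_radius C1w; exists (r + T) => i t x tT rx.
rewrite /diffq (proj1 (wr x _)); last by apply: le_lt_trans rx; rewrite lerDl.
rewrite (proj1 (wr (x + _) _)) ?subrr ?mulr0//.
have e1 : `|e_ i| <= 1.
  apply: rV_norm_le => // j; rewrite mxE eqxx/=; case: eqP => _;
    by rewrite ?normr1 ?normr0.
have te : `|t *: e_ i| <= T by rewrite normrZ -[T]mulr1 ler_pM.
have := ler_distD (x + t *: e_ i) x 0;
  rewrite !subr0 opprD addrA subrr sub0r normrN => xl.
rewrite -(ltrD2r T); apply: lt_le_trans rx _; apply: le_trans xl _.
by rewrite addrC lerD2l.
Qed.

Lemma measurable_diffq i (t : R) : measurable_fun setT (diffq i t).
Proof.
apply: measurable_funM => //; apply: measurable_funB;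
  last exact: C1c_measurable C1w.
exact: (measurableT_comp (C1c_measurable C1w) (measurable_addrV (t *: e_ i))).
Qed.

Lemma C1c_bounded : exists2 M : R, 0 < M & forall x, `|w x| <= M.
Proof.
have [_ _ cK _] := C1w.
have cG : compact (w @` closure [set y | w y != 0]).
  by apply: continuous_compact cK; apply: continuous_subspaceT;
    exact: C1c_continuous C1w.
have [M [_ MK]] := compact_bounded cG.
exists (`|M| + 1); first by rewrite ltr_wpDl.
move=> x; have [->|wx] := eqVneq (w x) 0; first by rewrite normr0 addr_ge0.
apply: MK; last by exists x => //; exact: subset_closure.
by rewrite (le_lt_trans (ler_norm _))// ltrDl.
Qed.

Lemma integrable_C1c : mu.-integrable setT (EFin \o w).
Proof.
have [r r0 wr] := C1c_supp_radius C1w.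
have [M M0 wM] := C1c_bounded.
apply: (integrable_bounded (C1c_measurable C1w) wM).
by move=> x /wr[]; exact.
Qed.

Lemma integral_diffq i (t : R) : (\int[mu]_x (diffq i t x)%:E = 0)%E.
Proof.
have iw := integrable_C1c.
have mw := C1c_measurable C1w.
have iwt : mu.-integrable setT (fun x => (w (x + t *: e_ i))%:E).
  apply/integrableP; split.
    by apply/measurable_EFinP; exact:
      (measurableT_comp mw (measurable_addrV _)).
  have [_] := integrableP _ _ _ iw; apply: le_lt_trans.
  rewrite (ge0_integral_translate (t *: e_ i) (f := fun x => `|(w x)%:E|%E))//.
  by apply: measurableT_comp => //; exact/measurable_EFinP.
have -> : (\int[mu]_x (diffq i t x)%:E =
  \int[mu]_x (t^-1%:E * ((w (x + t *: e_ i))%:E - (w x)%:E)))%E.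
  by apply: eq_integral => x _; rewrite -EFinB -EFinM.
rewrite integralZl//; last exact: integrableB.
rewrite integralB// (integral_translate (t *: e_ i) (f := EFin \o w)).
  by rewrite subee ?mule0//; exact: integrable_fin_num.
exact/measurable_EFinP.
Qed.

Lemma harmonic_norm_le (t : R) k : `|t * harmonic k| <= `|t|.
Proof.
rewrite normrM ler_piMr// ger0_norm ?harmonic_ge0//.
by rewrite invf_le1// ler1n.
Qed.

(** By translation invariance every difference quotient has integral 0, and the quotients converge
    boundedly to the partial derivative. *)
Lemma integral_grad_eq0 i : (\int[mu]_x (grad w x ord0 i)%:E = 0)%E.
Proof.
have [C C0 qC] := diffq_bounded; have [r qr] := diffq_supp (normr_ge0 1).
have /cvg_lim <- // := @bounded_cvg_integral (fun k => diffq i (1 * harmonic k))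
  (fun x => grad w x ord0 i) r C (fun k => measurable_diffq i _)
  (C1c_grad_measurable C1w i) (fun x => @diffq_cvg i 1 x (oner_neq0 _))
    (fun k => qC i _)
  (fun k x => qr i _ x (harmonic_norm_le 1 k)).
  rewrite (_ : (fun k => _) = cst 0%E); first exact: lim_cst.
  by apply/funext => k; exact: integral_diffq.
Qed.

Lemma integral_sqr_translate_coord_le i (t : R) :
  (\int[mu]_x ((w (x + t *: e_ i) - w x) ^+ 2)%:E <=
   (t ^+ 2)%:E * \int[mu]_x ((grad w x ord0 i) ^+ 2)%:E)%E.
Proof.
have mw := C1c_measurable C1w.
have mwt (h : 'rV[R]_n) : measurable_fun setT (fun x => (w (x + h) - w x) ^+ 2).
  apply: measurable_funX; apply: measurable_funB => //.
  exact: (measurableT_comp mw (measurable_addrV _)).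
have [->|t0] := eqVneq t 0.
  rewrite expr0n mul0e; under eq_integral do rewrite scale0r addr0 subrr
    expr0n/=.
  by rewrite integral0.
have [C C0 qC] := diffq_bounded; have [r qr] := diffq_supp (normr_ge0 t).
(* Cut the segment into [k + 1] pieces, apply Cauchy-Schwarz to the telescoping
   sum and use translation invariance; then let [k] tend to infinity. *)
have step k : (\int[mu]_x ((w (x + t *: e_ i) - w x) ^+ 2)%:E <=
   (t ^+ 2)%:E * \int[mu]_x ((diffq i (t * harmonic k) x) ^+ 2)%:E)%E.
  pose d := t * harmonic k; rewrite -/d.
  have d0 : d != 0 by rewrite mulf_neq0// gt_eqF// harmonic_gt0.
  have td : t = k.+1%:R * d by rewrite /d mulrCA mulfV ?mulr1// pnatr_eq0.
  pose a (j : 'I_k.+1) x := (w (x + (j%:R * d) *: e_ i + d *: e_ i) - w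
    (x + (j%:R * d) *: e_ i)) ^+ 2.
  have a0 j x : 0 <= a j x by exact: sqr_ge0.
  have ma j : measurable_fun setT (a j).
    exact: (measurableT_comp (mwt (d *: e_ i)) (measurable_addrV _)).
  apply: (@le_trans _ _ (\int[mu]_x (k.+1%:R%:E * \sum_j (a j x)%:E))%E).
    apply: ge0_le_integral => //.
    - by move=> x _; rewrite lee_fin sqr_ge0.
    - by apply/measurable_EFinP; exact: mwt.
    - by apply: measurable_funeM; apply: emeasurable_sum => j;
        apply/measurable_EFinP; exact: ma.
    move=> x _; rewrite sumEFin -EFinM lee_fin.
    apply: le_trans (sqr_sum_le _); rewrite le_eqVlt; apply/orP; left;
      apply/eqP; congr (_ ^+ 2).
    have := @telescope_sumr _ 0 k.+1 (fun j => w (x + (j%:R * d) *: e_ i))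
      (leq0n _).
    rewrite big_mkord td mul0r scale0r addr0 => <-.
    by apply: eq_bigr => j _; rewrite -natr1 mulrDl mul1r scalerDl addrA.
  rewrite ge0_integralZl//; last 2 first.
  - by apply: emeasurable_sum => j; apply/measurable_EFinP; exact: ma.
  - by move=> x _; apply: sume_ge0 => j _; rewrite lee_fin.
  rewrite ge0_integral_sum//; last 2 first.
  - by move=> j; apply/measurable_EFinP; exact: ma.
  - by move=> j x _; rewrite lee_fin.
  pose I := (\int[mu]_x ((w (x + d *: e_ i) - w x) ^+ 2)%:E)%E.
  have Ij j : (\int[mu]_x (a j x)%:E = I)%E.
    apply: (ge0_integral_translate ((j%:R * d) *: e_ i)
      (f := fun x => ((w (x + d *: e_ i) - w x) ^+ 2)%:E)).
    - by apply/measurable_EFinP; exact: mwt.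
    - by move=> x; rewrite lee_fin sqr_ge0.
  under eq_bigr do rewrite Ij.
  have -> : (\int[mu]_x ((diffq i d x) ^+ 2)%:E = ((d ^+ 2)^-1)%:E * I)%E.
    rewrite /I -ge0_integralZl//; last 3 first.
    - by apply/measurable_EFinP; exact: mwt.
    - by move=> x _; rewrite lee_fin sqr_ge0.
    - by rewrite lee_fin invr_ge0 sqr_ge0.
    by apply: eq_integral => x _; rewrite /diffq exprMn -EFinM exprVn.
  (* The [k + 1] equal integrals and the factor [k + 1] from Cauchy-Schwarz combine to
     [(k + 1)^2 = t^2 / d^2]. *)
  rewrite sume_const_ord 2!muleA -!EFinM.
  rewrite le_eqVlt; apply/orP; left; apply/eqP; congr (_%:E * _)%E.
  rewrite {1}td exprMn mulfK; first by rewrite -expr2.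
  by rewrite expf_neq0.
have lim : ((t ^+ 2)%:E * \int[mu]_x ((diffq i (t * harmonic k) x) ^+ 2)%:E)%E
  @[k --> \oo] -->
    ((t ^+ 2)%:E * \int[mu]_x ((grad w x ord0 i) ^+ 2)%:E)%E.
  apply: cvgeZl => //.
  apply: (@bounded_cvg_integral (fun k x => diffq i (t * harmonic k) x ^+ 2) _ r
    (C ^+ 2)).
  - by move=> k; apply: measurable_funX; exact: measurable_diffq.
  - by apply: measurable_funX; exact: C1c_grad_measurable C1w i.
  - by move=> x; rewrite expr2; under eq_fun do rewrite expr2; apply: cvgM;
      exact: diffq_cvg.
  - by move=> k x; rewrite normrX ler_sqr ?nnegrE// ltW.
  - by move=> k x rx; rewrite (qr i _ x (harmonic_norm_le t k) rx) expr0n.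
by apply: cvge_ge lim; exact: nearW.
Qed.

Lemma measurable_sqr_translate h :
  measurable_fun setT (fun x => (w (x + h) - w x) ^+ 2).
Proof.
have mw := C1c_measurable C1w.
apply: measurable_funX; apply: measurable_funB => //.
exact: (measurableT_comp mw (measurable_addrV _)).
Qed.

Definition dirichlet : \bar R :=
  (\sum_i \int[mu]_x ((grad w x ord0 i) ^+ 2)%:E)%E.

(** Follow the staircase from [x] to [x + h]: Cauchy-Schwarz over its [n] segments gives the factor
    [n], and translation invariance moves the start of each segment back to [x]. *)
Lemma integral_sqr_translate_le h (r : R) : (forall i, `|h ord0 i| <= r) ->
  (\int[mu]_x ((w (x + h) - w x) ^+ 2)%:E <= (n%:R * r ^+ 2)%:E * dirichlet)%E.
Proof.
move=> hr.
pose a i x := (w (x + row_prefix h i + h ord0 i *: e_ i) - w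
  (x + row_prefix h i)) ^+ 2.
have ma i : measurable_fun setT (a i).
  exact: (measurableT_comp (measurable_sqr_translate (h ord0 i *: e_ i))
    (measurable_addrV _)).
have a0 i x : 0 <= a i x by exact: sqr_ge0.
apply: (@le_trans _ _ (\int[mu]_x (n%:R%:E * \sum_i (a i x)%:E))%E).
  apply: ge0_le_integral => //.
  - by move=> x _; rewrite lee_fin sqr_ge0.
  - by apply/measurable_EFinP; exact: measurable_sqr_translate.
  - by apply: measurable_funeM; apply: emeasurable_sum => j;
      apply/measurable_EFinP; exact: ma.
  move=> x _; rewrite sumEFin -EFinM lee_fin telescope_row_prefix.
  exact: sqr_sum_le.
rewrite ge0_integralZl//; last 2 first.
- by apply: emeasurable_sum => j; apply/measurable_EFinP; exact: ma.
- by move=> x _; apply: sume_ge0 => j _; rewrite lee_fin.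
rewrite ge0_integral_sum//; last 2 first.
- by move=> j; apply/measurable_EFinP; exact: ma.
- by move=> j x _; rewrite lee_fin.
rewrite EFinM -muleA; apply: lee_wpmul2l => //.
rewrite /dirichlet ge0_sume_distrr; last first.
  by move=> i _; apply: integral_ge0 => x _; rewrite lee_fin sqr_ge0.
apply: lee_sum => i _.
apply: (@le_trans _ _ (((h ord0 i) ^+ 2)%:E *
  \int[mu]_x ((grad w x ord0 i) ^+ 2)%:E)%E).
  apply: le_trans (integral_sqr_translate_coord_le i (h ord0 i)).
  rewrite (ge0_integral_translate (row_prefix h i)
    (f := fun x => ((w (x + h ord0 i *: e_ i) - w x) ^+ 2)%:E))//.
  - by apply/measurable_EFinP; exact: measurable_sqr_translate.
  - by move=> x; rewrite lee_fin sqr_ge0.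
apply: lee_wpmul2r; first by apply: integral_ge0 => x _;
  rewrite lee_fin sqr_ge0.
rewrite lee_fin -real_normK ?num_real// ler_sqr ?nnegrE//.
exact: le_trans (normr_ge0 _) (hr i).
Qed.

Lemma measurable_neq0 : measurable [set x | w x != 0].
Proof.
have -> : [set x | w x != 0] = setT `&` w @^-1` (~` [set 0]).
  by rewrite setTI; apply/seteqP; split => x /= /eqP.
exact: (C1c_measurable C1w measurableT (measurableC (measurable_set1 _))).
Qed.

Lemma measurable_sqr_diff :
  measurable_fun setT (fun p : 'rV[R]_n * 'rV[R]_n =>
    (w (p.1 + p.2) - w p.1) ^+ 2).
Proof.
have mw := C1c_measurable C1w.
apply: measurable_funX; apply: measurable_funB.
  apply: (measurableT_comp (f := w)
    (g := fun p : 'rV[R]_n * 'rV[R]_n => p.1 + p.2)) => //.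
  apply/measurable_fun_rVP => i; under eq_fun do rewrite mxE.
  apply: measurable_funD.
    exact: (measurableT_comp (f := fun x : 'rV[R]_n => x ord0 i)
      (measurable_coord i)).
  exact: (measurableT_comp (f := fun x : 'rV[R]_n => x ord0 i)
    (measurable_coord i)).
exact: measurableT_comp.
Qed.

(* Integrate [(w (x + h) - w x)^2] over [x] and over [h] in the cube: for each
   [x], the points [h] with [w (x + h) = 0] fill at least half of the cube. *)
Lemma faber_krahn (r : R) : 0 < r ->
  (mu [set x | w x != 0%R] <= ((2 * r) ^+ n / 2)%:E)%E ->
  (\int[mu]_x ((w x) ^+ 2)%:E <= (2 * (n%:R * r ^+ 2))%:E * dirichlet)%E.
Proof.
move=> r0 wr.
pose V := (2 * r) ^+ n; have V0 : 0 < V by rewrite exprn_gt0// mulr_gt0.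
pose F (p : 'rV[R]_n * 'rV[R]_n) : \bar R :=
  (\1_(cube r) p.2 * (w (p.1 + p.2) - w p.1) ^+ 2)%:E.
have mcube := measurable_cube r.
have muC : mu (cube r) = V%:E by rewrite lebesgue_cube// ltW.
have mF : measurable_fun setT F.
  apply/measurable_EFinP; apply: measurable_funM;
    last exact: measurable_sqr_diff.
  by apply: measurableT_comp => //; exact: measurable_indic.
have F0 p : (0 <= F p)%E by rewrite lee_fin mulr_ge0// sqr_ge0.
have D0 : (0 <= dirichlet)%E.
  by apply: sume_ge0 => i _; apply: integral_ge0 => x _;
    rewrite lee_fin sqr_ge0.
have upper : (\int[mu]_h \int[mu]_x F (x, h) <=
  V%:E * ((n%:R * r ^+ 2)%:E * dirichlet))%E.
  apply: (@le_trans _ _ (\int[mu]_h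
    ((n%:R * r ^+ 2)%:E * dirichlet * (\1_(cube r) h)%:E))%E).
    apply: ge0_le_integral => //.
    - by move=> h _; exact: integral_ge0.
    - exact: (measurable_fun_fubini_tonelli_G F).
    - by apply: measurable_funeM; apply/measurable_EFinP;
        exact: measurable_indic.
    move=> h _; have [rh|rh] := pselect (cube r h); last first.
      rewrite indicE memNset// mule0 /F/=.
      under eq_integral do rewrite indicE memNset// mul0r.
      by rewrite integral0.
    rewrite indicE mem_set// mule1 /F/=.
    under eq_integral do rewrite indicE mem_set// mul1r.
    apply: integral_sqr_translate_le => i; have := rh i.
    by rewrite /= in_itv/= -ler_norml.
  rewrite ge0_integralZl//; last 2 first.
  - by apply/measurable_EFinP; exact: measurable_indic.
  - by apply: mule_ge0 => //; rewrite lee_fin mulr_ge0 ?sqr_ge0.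
  by rewrite integral_indic// setIT muleC [X in (X * _)%E]muC.
rewrite -fubini_tonelli// in upper.
have lower x : ((V / 2)%:E * (w x ^+ 2)%:E <= \int[mu]_h F (x, h))%E.
  pose Z := [set h | w (x + h) = 0].
  have mZC : measurable ((fun h => h + x) @^-1` [set x | w x != 0]).
    by rewrite -[X in measurable X]setTI; apply: measurable_addrV => //;
      exact: measurable_neq0.
  have mZ : measurable Z.
    rewrite (_ : Z = ~` ((fun h => h + x) @^-1` [set x | w x != 0])).
      exact: measurableC.
    apply/seteqP; split => h /=; rewrite /Z/= addrC; first by move=> ->;
      rewrite eqxx.
    by move/negP; rewrite negbK => /eqP.
  have mCZ : measurable (cube r `&` Z) by exact: measurableI.
  (* The rest of the cube lies in a translate of the set where [w] is nonzero, which has measure at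
     most [V / 2]. *)
  have VZ : ((V / 2)%:E <= mu (cube r `&` Z))%E.
    have : (V%:E <= mu (cube r `&` Z) + (V / 2)%:E)%E.
      rewrite -muC (_ : cube r = (cube r `&` Z) `|` (cube r `&` ~` Z));
        last by rewrite -setIUr setUv setIT.
      apply: le_trans (measureU2 _ _ _) _ => //.
        by apply: measurableI => //; exact: measurableC.
      rewrite -setIUr setUv setIT leeD2l//.
      apply: le_trans wr; rewrite -(lebesgue_rV_translate x measurable_neq0).
      apply: le_measure; rewrite ?inE//.
        by apply: measurableI => //; exact: measurableC.
      by move=> h [_]; rewrite /Z/= addrC => /eqP.
    rewrite -leeBlDr// -EFinB; congr (_ <= _)%E; congr _%:E; lra.
  apply: (@le_trans _ _ (\int[mu]_h
    ((w x ^+ 2)%:E * (\1_(cube r `&` Z) h)%:E))%E).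
    rewrite ge0_integralZl//; last 2 first.
    - by apply/measurable_EFinP; exact: measurable_indic.
    - by rewrite lee_fin sqr_ge0.
    by rewrite integral_indic// setIT muleC lee_wpmul2l// lee_fin sqr_ge0.
  apply: ge0_le_integral => //.
  - by move=> h _; rewrite mule_ge0// lee_fin// sqr_ge0.
  - by apply: measurable_funeM; apply/measurable_EFinP; exact: measurable_indic.
  - exact: (measurableT_comp mF).
  move=> h _; rewrite /F/= !indicE -EFinM lee_fin.
  have [[rh Zh]|] := pselect ((cube r `&` Z) h).
    by rewrite !mem_set// mulr1 mul1r Zh sub0r sqrrN.
  by move=> nh; rewrite memNset// mulr0 mulr_ge0// sqr_ge0.
have : ((V / 2)%:E * \int[mu]_x ((w x) ^+ 2)%:E <=
  V%:E * ((n%:R * r ^+ 2)%:E * dirichlet))%E.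
  apply: le_trans upper; rewrite -ge0_integralZl//; last 3 first.
  - by apply/measurable_EFinP; apply: measurable_funX;
      exact: C1c_measurable C1w.
  - by move=> x _; rewrite lee_fin sqr_ge0.
  - by rewrite lee_fin divr_ge0// ltW.
  apply: ge0_le_integral => //.
  - by move=> x _; rewrite -EFinM lee_fin mulr_ge0 ?sqr_ge0// divr_ge0// ltW.
  - apply: measurable_funeM; apply/measurable_EFinP; apply: measurable_funX.
    exact: C1c_measurable C1w.
  - exact: (measurable_fun_fubini_tonelli_F F).
rewrite (_ : (V%:E * _ = (V / 2)%:E *
  ((2 * (n%:R * r ^+ 2))%:E * dirichlet))%E).
  by rewrite lee_pmul2l// lte_fin divr_gt0.
rewrite !muleA -!EFinM; congr (_%:E * _)%E; lra.
Qed.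

End C1c_integrals.
End faber_krahn.

(** * Gluing and truncation *)

Section gluing.
Context {R : realType} {n : nat}.
Implicit Types (x y h : 'rV[R]_n) (f w u phi : 'rV[R]_n -> R) (i : 'I_n)
  (Omega K : set 'rV[R]_n).

Local Notation mu := (@lebesgue_rV R n).
Local Notation e_ i := (delta_mx (ord0 : 'I_1) i : 'rV[R]_n).

Lemma row_continuous (T : topologicalType) (F : T -> 'rV[R]_n) (a : T) :
  (forall i, {for a, continuous (fun b => F b ord0 i)}) ->
    {for a, continuous F}.
Proof.
move=> Fi; apply/(@cvgrPdist_lt _ _ _ _ (@nbhs_filter _ a)) => e e0.
have : \forall b \near a, forall i, `|F a ord0 i - F b ord0 i| < e.
  apply: filter_forall => i.
  by have /(@cvgrPdist_lt _ _ _ _ (@nbhs_filter _ a)) := Fi i; exact.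
by apply: filterS => b Fb; apply: rV_norm_lt => // i; rewrite !mxE; exact: Fb.
Qed.

(** Regularity inside [Omega] suffices: a point outside [Omega] is off the closed set [K], hence has
    a neighbourhood on which [w] is identically 0. *)
Lemma C1c_glue Omega K w : open Omega -> compact K -> K `<=` Omega ->
  (forall x, ~ K x -> w x = 0) ->
  (forall x i, Omega x -> derivable w x (e_ i)) ->
  (forall x i, Omega x -> {for x, continuous (fun y => grad w y ord0 i)}) ->
  C1c Omega w.
Proof.
move=> oO cK KO wK dw cw.
have clK : closed K by exact: compact_closed (@norm_hausdorff _ _) cK.
have nK x : ~ K x -> \forall y \near x, ~ K y.
  by move=> nKx; apply: open_nbhs_nbhs; split=> //; exact: closed_openC.
have w0 x : ~ K x -> \forall y \near x, w y = 0.
  by move=> nKx; apply: filterS (nK _ nKx) => y; exact: wK.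
have KC x : ~ Omega x -> ~ K x by move=> Ox /KO.
have supK : closure [set x | w x != 0] `<=` K.
  rewrite ((closure_id K).1 clK)//; apply: closure_subset => x /= wx.
  by apply: contrapT => /wK /eqP; exact/negP.
split.
- move=> x i; have [|/KC/w0 wx] := pselect (Omega x); first exact: dw.
  apply: (@near_eq_derivable _ _ _ (cst 0)); last exact: derivable_cst.
  by apply: filterS wx => y /= ->.
- move=> x; apply: row_continuous => i.
  have [|/KC/nK nKx] := pselect (Omega x); first exact: cw.
  have g0 : {near x, cst 0 =1 (fun y => grad w y ord0 i)}.
    by apply: filterS nKx => y /w0/grad_near0 ->; rewrite mxE.
  apply: cvg_trans (near_eq_cvg g0) _ => /=.
  by rewrite -(nbhs_singleton g0); exact: cvg_cst.
- apply: subclosed_compact cK supK; exact: closed_closure.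
- exact: subset_trans supK KO.
Qed.

Lemma bounded_closure Omega : bounded_set Omega -> compact (closure Omega).
Proof.
move=> [M [_ OM]].
have cB : closed [set x : 'rV[R]_n | `|x| <= `|M| + 1].
  apply: (@preimage_closed _ _ (fun x : 'rV[R]_n => `|x|)
    [set t | t <= `|M| + 1]).
    by move=> x _; exact: norm_continuous.
  exact: closed_le.
have OB : Omega `<=` [set x : 'rV[R]_n | `|x| <= `|M| + 1].
  by move=> x Ox; apply: OM Ox; rewrite (le_lt_trans (ler_norm _))// ltrDl.
have cOB : closure Omega `<=` [set x : 'rV[R]_n | `|x| <= `|M| + 1].
  by apply: subset_trans (closure_subset OB) _; rewrite -((closure_id _).1 cB).
apply: (subclosed_compact _ _ cOB); first exact: closed_closure.
apply: bounded_closed_compact => //.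
exists (`|M| + 1); split; first exact: num_real.
by move=> y My x /= /le_trans; apply; exact: ltW.
Qed.

(** Since [u] is only known to be derivable in the direction [v], the chain rule is applied to its
    restriction to a line, where derivability and differentiability coincide. *)
Lemma is_derive_scalar_comp (F : R -> R) u x v (F' : R) :
  derivable u x v -> is_derive (u x) 1 F F' ->
  is_derive x v (F \o u) (F' * 'D_v u x).
Proof.
move=> du [dF F'E].
pose g (h : R) := u (h *: v + x).
have dg : derivable g 0 1 by exact: (derivable1P u x v).1 du.
have g0 : g 0 = u x by rewrite /g scale0r add0r.
have dgE f : 'D_v f x = 'D_1 (fun h : R => f (h *: v + x)) 0.
  have E : (fun h : R => h^-1 *: ((f \o shift x) (h *: v) - f x)) =
      (fun h : R => h^-1 *: (((fun s : R => f (s *: v + x)) \o shift 0) (h *: 1)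
        - f (0 *: v + x))).
    by apply/funext => h /=; rewrite addr0 scale0r add0r [h%:A]mulr1.
  by rewrite /derive E.
have dFg : derivable F (g 0) 1 by rewrite g0.
apply: DeriveDef.
  apply: (derivable1P (F \o u) x v).2; apply/derivable1_diffP.
  by apply: (@differentiable_comp _ _ _ _ g F); apply/derivable1_diffP.
rewrite [LHS]dgE [X in _ * X]dgE -/g -!derive1E.
by rewrite (@derive1_comp _ g F 0)// derive1E g0 F'E.
Qed.

Definition pos_above (k t : R) := Num.max (t - k) 0.

Lemma pos_above_ge0 k t : 0 <= pos_above k t.
Proof. by rewrite le_max lexx orbT. Qed.

Lemma continuous_pos_above k : continuous (pos_above k).
Proof.
move=> t; apply: (@continuous_max _ _ (fun s => s - k) (cst 0)).
  by apply: cvgB; [exact: cvg_id|exact: cvg_cst].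
exact: cvg_cst.
Qed.

(** The exponent is at least 2, so the corner at [k] is smoothed out: the difference quotient there
    is [(h^+)^(m+1)], which tends to 0. *)
Lemma is_derive_pos_above k (m : nat) (t : R) :
  is_derive t 1 (fun s => pos_above k s ^+ m.+2)
    (m.+2%:R * pos_above k t ^+ m.+1).
Proof.
have [tk|kt|->] := ltgtP t k.
- have -> : pos_above k t = 0 by apply/max_idPr; rewrite subr_le0 ltW.
  rewrite expr0n mulr0; apply: (@near_eq_is_derive _ _ _ (cst 0)).
  near=> s; rewrite /= (_ : pos_above k s = 0) ?expr0n//.
  apply/max_idPr; rewrite subr_le0 ltW//; near: s; exact: lt_nbhsl.
- have -> : pos_above k t = t - k by apply/max_idPl; rewrite subr_ge0 ltW.
  apply: (@near_eq_is_derive _ _ _ (fun s => (s - k) ^+ m.+2)).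
    near=> s; congr (_ ^+ _); apply/esym/max_idPl; rewrite subr_ge0 ltW//.
    by near: s; exact: lt_nbhsr.
  have d1 : is_derive t 1 (fun s : R => s - k) (1 - 0).
    by apply: is_deriveB.
  by have := is_deriveX m.+2 d1; rewrite exprfctE subr0 [_%:A]mulr1.
- have k0 : pos_above k k = 0 by rewrite /pos_above subrr maxxx.
  rewrite k0 expr0n/= mulr0.
  have lim : h^-1 *: (((fun s => pos_above k s ^+ m.+2) \o shift k) (h *: 1)
      - pos_above k k ^+ m.+2) @[h --> (0 : R)^'] --> (0 : R).
    have c0 : pos_above 0 h ^+ m.+1 @[h --> (0 : R)^'] --> (0 : R).
      have E : pos_above 0 0 ^+ m.+1 =
        0 by rewrite /pos_above subrr maxxx expr0n.
      rewrite -[X in _ --> X]E; apply: cvg_within_filter;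
        apply: (@continuous_comp _ _ _ (pos_above 0) (fun t => t ^+ m.+1)).
        exact: continuous_pos_above.
      exact: exprn_continuous.
    apply: cvg_trans c0; apply: near_eq_cvg; near=> h.
    have h0 : h != 0 by near: h; exact: nbhs_dnbhs_neq.
    rewrite /= k0 expr0n/= subr0 [h *: 1]mulr1 /pos_above addrK subr0.
    have [h1|h1] := ltP 0 h.
      by rewrite -[h^-1 *: _]/(h^-1 * _) [h ^+ m.+2]exprS mulrA mulVf ?mul1r.
    by rewrite !expr0n scaler0.
  apply: DeriveDef; last exact: cvg_lim lim.
  by apply/cvg_ex; exists 0.
Unshelve. all: by end_near. Qed.

End gluing.

(** * Functions of class C^1 up to the boundary *)

Section C1_closure_theory.
Context {R : realType} {n : nat}.
Implicit Types (x y h : 'rV[R]_n) (f w phi : 'rV[R]_n -> R) (i : 'I_n).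

Local Notation mu := (@lebesgue_rV R n).
Local Notation e_ i := (delta_mx (ord0 : 'I_1) i : 'rV[R]_n).

Lemma open_continuous_measurable_rV (D : set 'rV[R]_n) f : open D ->
  (forall x, D x -> {for x, continuous f}) -> measurable_fun D f.
Proof.
move=> oD cf; apply: (measurability _ (RGenOpens.measurableE R)).
move=> _ [_ [a [b ->] <-]]; apply: open_measurable_rV.
rewrite openE => x [Dx fx]; apply: filterI; first by apply: open_nbhs_nbhs.
apply: (cf x Dx); apply: open_nbhs_nbhs; split => //; exact: interval_open.
Qed.

Lemma compact_integrable_norm (K : set 'rV[R]_n) f : compact K ->
  measurable_fun K f -> {within K, continuous f} ->
  (\int[mu]_(x in K) `|f x|%:E < +oo)%E.
Proof.
move=> cK mf cf.
have mK : measurable K.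
  by apply: closed_measurable_rV; apply: compact_closed => //;
    exact: norm_hausdorff.
have [r [_ rK]] := compact_bounded cK.
have [M [_ MK]] := compact_bounded (continuous_compact cf cK).
have : mu.-integrable K (EFin \o f).
  apply: measurable_bounded_integrable => //.
    apply: (@lebesgue_rV_bounded _ _ _ (`|r| + 1)) => // x Kx; apply: rK => //.
    by rewrite (le_lt_trans (ler_norm _))// ltrDl.
  exists M; split; first exact: num_real.
  by move=> y My x Kx; apply: MK => //; exists x.
by move/integrableP => [_].
Qed.

Section C1_closure_fun.
Variables (Omega : set 'rV[R]_n) (u : 'rV[R]_n -> R).
Hypotheses (oO : open Omega) (bO : bounded_set Omega)
  (C1u : C1_closure Omega u).

Lemma C1_closure_continuous x : Omega x -> {for x, continuous u}.
Proof.
case: C1u => cu _ _ Ox.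
have := continuous_subspaceW (@subset_closure _ Omega) cu.
by rewrite continuous_open_subspace//; apply; rewrite inE.
Qed.

Lemma C1_closure_grad_continuous x i : Omega x ->
  {for x, continuous (fun y => grad u y ord0 i)}.
Proof.
case: C1u => _ _ [G cG GE] Ox.
have := continuous_subspaceW (@subset_closure _ Omega) cG.
rewrite continuous_open_subspace// => /(_ x); rewrite inE => /(_ Ox) cGx.
have GiE : {near x, (fun y => G y ord0 i) =1 (fun y => grad u y ord0 i)}.
  have : nbhs x Omega by apply: open_nbhs_nbhs.
  by apply: filterS => y Oy; rewrite GE.
apply: cvg_trans (near_eq_cvg GiE) _.
rewrite -(nbhs_singleton GiE).
apply: (@continuous_comp _ _ _ G (fun y : 'rV[R]_n => y ord0 i)) => //.
exact: coord_continuous.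
Qed.

Lemma C1_closure_derivable x i : Omega x -> derivable u x (e_ i).
Proof. by case: C1u => _ + _; exact. Qed.

Lemma C1_closure_bounded : exists2 S : R, 0 < S & forall x, Omega x -> `|u x| <=
  S.
Proof.
case: C1u => cu _ _.
have [M [_ MK]] := compact_bounded (continuous_compact cu (bounded_closure bO)).
exists (`|M| + 1); first by rewrite ltr_wpDl.
move=> x Ox; apply: MK; last by exists x => //; exact: subset_closure.
by rewrite (le_lt_trans (ler_norm _))// ltrDl.
Qed.

Lemma C1_closure_L1loc_grad i : L1loc Omega (fun x => grad u x ord0 i).
Proof.
have mg : measurable_fun Omega (fun x => grad u x ord0 i).
  by apply: open_continuous_measurable_rV => // x;
    exact: C1_closure_grad_continuous.
split => // K KO cK; apply: compact_integrable_norm => //.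
  apply: measurable_funS KO mg; exact: open_measurable_rV.
apply: continuous_in_subspaceT => x; rewrite inE => /KO;
  exact: C1_closure_grad_continuous.
Qed.

Lemma grad_mul w phi x i : derivable w x (e_ i) -> derivable phi x (e_ i) ->
  grad (fun y => w y * phi y) x ord0 i =
  w x * grad phi x ord0 i + phi x * grad w x ord0 i.
Proof. by move=> dw dphi; rewrite !mxE; exact: deriveM. Qed.

(** Outside [Omega] the function [u] need not be differentiable, but the product vanishes off the
    support of [phi], which serves as the compact set in [C1c_glue]. *)
Lemma C1c_mul phi : C1c Omega phi -> C1c Omega (fun x => u x * phi x).
Proof.
move=> C1phi; have [dphi _ cK KO] := C1phi.
apply: (C1c_glue oO cK KO).
- by move=> x /closure_support_near0/nbhs_singleton ->; rewrite mulr0.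
- by move=> x i Ox; apply: derivableM => //; exact: C1_closure_derivable.
- move=> x i Ox.
  have gE : {near x, (fun y => u y * grad phi y ord0 i + phi y *
    grad u y ord0 i) =1
      (fun y => grad (fun y => u y * phi y) y ord0 i)}.
    have : nbhs x Omega by apply: open_nbhs_nbhs.
    apply: filterS => y Oy; rewrite grad_mul//; exact: C1_closure_derivable.
  apply: cvg_trans (near_eq_cvg gE) _.
  rewrite -(nbhs_singleton gE); apply: cvgD; apply: cvgM.
  + exact: C1_closure_continuous.
  + exact: (C1c_grad_continuous C1phi).
  + exact: (C1c_continuous C1phi).
  + exact: C1_closure_grad_continuous.
Qed.

Lemma C1_closure_weak_gradient : measurable_fun setT u ->
  weak_gradient Omega u (grad u).
Proof.
move=> mfu i; split; first exact: C1_closure_L1loc_grad.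
move=> phi C1phi.
(* Integration by parts: the partial derivatives of [u * phi] have integral 0.
  *)
have C1w := C1c_mul C1phi.
pose w x := u x * phi x.
pose a x := u x * grad phi x ord0 i.
(* By the product rule [b] is [D_i u * phi] on [Omega], and it is 0 elsewhere; as a difference of
   integrable functions it is integrable on the whole space. *)
pose b x := grad w x ord0 i - a x.
have [dphi _ cK KO] := C1phi.
have nO x : ~ Omega x -> phi x = 0 /\ grad phi x = 0.
  move=> Ox; have /closure_support_near0 p0 :
    ~ closure [set y | phi y != 0] x by move=> /KO.
  by split; [exact: nbhs_singleton p0|exact: grad_near0].
have nOw x : ~ Omega x -> grad w x = 0.
  have [_ _ _ KOw] := C1w.
  by move=> Ox; apply/grad_near0/closure_support_near0 => /KOw.
have [S S0 uS] := C1_closure_bounded.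
have [C C0 gC] := C1c_grad_bounded C1phi.
have [D D0 gD] := C1c_grad_bounded C1w.
have [r r0 pr] := C1c_supp_radius C1phi.
have [q q0 pq] := C1c_supp_radius C1w.
have ia : mu.-integrable setT (EFin \o a).
  apply: (@integrable_bounded _ _ a r (S * C)).
  - by apply: measurable_funM => //; exact: C1c_grad_measurable C1phi i.
  - move=> x; rewrite /a normrM; have [Ox|/nO[_ ->]] := pselect (Omega x).
      by rewrite ler_pM// uS.
    by rewrite mxE normr0 mulr0 mulr_ge0// ltW.
  - by move=> x /pr[_]; rewrite /a => ->; rewrite mxE mulr0.
have ig : mu.-integrable setT (EFin \o (fun x => grad w x ord0 i)).
  apply: (@integrable_bounded _ _ _ q D) => //.
  - exact: C1c_grad_measurable C1w i.
  - by move=> x /pq[_ ->]; rewrite mxE.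
rewrite Rintegral_mkcond [in RHS]Rintegral_mkcond.
have -> : (fun x => u x * grad phi x ord0 i) \_ Omega = a.
  apply/funext => x; rewrite patchE; case: ifPn => // /negP;
    rewrite inE => /nO[_ g0].
  by rewrite /a g0 mxE mulr0.
have -> : (fun x => grad u x ord0 i * phi x) \_ Omega = b.
  apply/funext => x; rewrite patchE /b /a; case: ifPn => [|/negP];
    rewrite inE => Ox.
    rewrite grad_mul//; last exact: C1_closure_derivable.
    by rewrite addrC addKr mulrC.
  by have [_ ->] := nO _ Ox; rewrite nOw// !mxE mulr0 subrr.
rewrite RintegralB// opprB.
have -> : \int[mu]_x grad w x ord0 i = 0.
  by rewrite /Rintegral (integral_grad_eq0 C1w).
by rewrite subr0.
Qed.

(** The part of [closure Omega] where [u >= k] is compact, and it lies in [Omega] because [k > 0]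
    while [u <= 0] off [Omega]. It is the set to which [C1c_glue] is applied. *)
Lemma C1c_pos_above (k : R) (m : nat) : 0 < k ->
  (forall x, ~ Omega x -> u x <= 0) ->
  C1c Omega (fun x => pos_above k (u x) ^+ m.+2) /\
  forall x i, Omega x -> grad (fun x => pos_above k (u x) ^+ m.+2) x ord0 i =
    m.+2%:R * pos_above k (u x) ^+ m.+1 * grad u x ord0 i.
Proof.
move=> k0 u0.
have dF x i : Omega x -> is_derive x (e_ i) (fun x => pos_above k (u x) ^+ m.+2)
    (m.+2%:R * pos_above k (u x) ^+ m.+1 * 'D_(e_ i) u x).
  move=> Ox; apply: (is_derive_scalar_comp
    (F := fun s => pos_above k s ^+ m.+2)).
    exact: C1_closure_derivable.
  exact: is_derive_pos_above.
have gF x i : Omega x -> grad (fun x => pos_above k (u x) ^+ m.+2) x ord0 i =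
    m.+2%:R * pos_above k (u x) ^+ m.+1 * grad u x ord0 i.
  by move=> Ox; rewrite !mxE; have [_] := dF x i Ox.
split => //.
case: (C1u) => cu _ _.
pose K := closure Omega `&` u @^-1` [set t | k <= t].
have KO : K `<=` Omega.
  move=> x [_ /= kx]; apply: contrapT => /u0 ux.
  by have := lt_le_trans k0 (le_trans kx ux); rewrite ltxx.
(* Continuity of [u] is relative to [closure Omega], so the preimage is only the trace of a closed
   set [V]. *)
have clK : closed K.
  have /closed_subspaceP[V clV VE] :
    closed (u @^-1` [set t | k <= t] : set (subspace (closure Omega))).
    by apply: preimage_closed; [move=> x _; exact: cu|exact: closed_ge].
  by rewrite /K setIC -VE; apply: closedI => //; exact: closed_closure.
have cK : compact K.
  by apply: subclosed_compact clK (bounded_closure bO) _ => x [].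
apply: (C1c_glue oO cK KO).
- move=> x nKx; rewrite (_ : pos_above k (u x) = 0) ?expr0n//.
  apply/max_idPr; rewrite subr_le0 leNgt; apply/negP => kx; apply: nKx; split;
    last exact: ltW.
  apply: subset_closure; apply: contrapT => /u0; apply/negP; rewrite -ltNge.
  exact: lt_trans k0 kx.
- by move=> x i /(dF x i)[].
- move=> x i Ox.
  have gE : {near x, (fun y => m.+2%:R * pos_above k (u y) ^+ m.+1 *
    grad u y ord0 i) =1
      (fun y => grad (fun x => pos_above k (u x) ^+ m.+2) y ord0 i)}.
    have : nbhs x Omega by apply: open_nbhs_nbhs.
    by apply: filterS => y Oy; rewrite gF.
  apply: cvg_trans (near_eq_cvg gE) _.
  rewrite -(nbhs_singleton gE); apply: cvgM;
    last exact: C1_closure_grad_continuous.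
  apply: cvgMr; apply: (@continuous_comp _ _ _ u
    (fun s => pos_above k s ^+ m.+1)).
    exact: C1_closure_continuous.
  apply: (@continuous_comp _ _ _ (pos_above k) (fun s => s ^+ m.+1)).
    exact: continuous_pos_above.
  exact: exprn_continuous.
Qed.

End C1_closure_fun.
End C1_closure_theory.

(** * Energy estimate and decay of superlevel sets *)

Section Linfty_ae.
Context {R : realType} {n : nat}.
Local Notation mu := (@lebesgue_rV R n).

Lemma Linfty_norm_ae (Omega : set 'rV[R]_n) (f : 'rV[R]_n -> R) (C : R) :
  0 <= C ->
  (Linfty_norm Omega f <= C%:E)%E <-> {ae mu, forall x, Omega x -> `|f x| <= C}.
Proof.
move=> C0; rewrite /Linfty_norm unlock; case: ifPn => [_|mu0].
  split=> [/ess_supP|H]; [|apply/ess_supP; move: H]; apply: filterS => x /=.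
    by move=> + Ox; rewrite patchE mem_set.
  rewrite patchE; case: ifPn => [|_ _]; last by rewrite /= normr0 lee_fin.
  by rewrite inE => Ox /(_ Ox).
(* If the whole space is null, the norm is 0 by convention and every property holds almost
   everywhere. *)
split=> _; last by rewrite lee_fin.
exists setT; split => //.
by apply/eqP; rewrite eq_le measure_ge0 andbT leNgt.
Qed.

Lemma Linfty_norm_ge0 (Omega : set 'rV[R]_n) (f : 'rV[R]_n -> R) :
  (0 <= Linfty_norm Omega f)%E.
Proof. exact: Lnorm_ge0. Qed.

(** The majorant first yields the integrability of [f]; then the triangle inequality and
    monotonicity of the integral apply. *)
Lemma ae_le_Rintegral (f b : 'rV[R]_n -> R) : measurable_fun setT f ->
  mu.-integrable setT (EFin \o b) -> (forall x, 0 <= b x) ->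
  {ae mu, forall x, `|f x| <= b x} ->
  `|\int[mu]_x f x| <= \int[mu]_x b x.
Proof.
move=> mf ib b0 fb.
have mb : measurable_fun setT b by apply/measurable_EFinP; case/integrableP: ib.
have fb' : (\int[mu]_x `|(f x)%:E| <= \int[mu]_x (b x)%:E)%E.
  apply: ae_ge0_le_integral => //.
  - by apply: measurableT_comp => //; exact/measurable_EFinP.
  - by move=> x _; rewrite lee_fin.
  - exact/measurable_EFinP.
  - by apply: filterS fb => x fbx _; rewrite /= lee_fin.
have iff : mu.-integrable setT (EFin \o f).
  apply/integrableP; split; first exact/measurable_EFinP.
  apply: le_lt_trans fb' _; have /integrableP[_] := ib.
  apply: le_lt_trans; apply: ge0_le_integral => //.
  - by move=> x _; rewrite lee_fin.
  - exact/measurable_EFinP.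
  - by apply: measurableT_comp => //; exact/measurable_EFinP.
  - by move=> x _; rewrite lee_fin ler_norm.
apply: le_trans (le_normr_Rintegral measurableT iff) _.
apply: fine_le => //.
- by apply: integrable_fin_num => //; exact: integrable_abse iff.
- exact: integrable_fin_num.
Qed.

End Linfty_ae.

(** * Truncations of the subsolution and their energy *)

Section small_domain.
Context {R : realType} {n : nat}.
Variables (s : R) (Omega : set 'rV[R]_n) (c g u : 'rV[R]_n -> R) (M N S : R).

Local Notation mu := (@lebesgue_rV R n).
Local Notation e_ i := (delta_mx (ord0 : 'I_1) i : 'rV[R]_n).

Hypotheses (oO : open Omega) (bO : bounded_set Omega).
Hypotheses (mc : measurable_fun Omega c) (mg : measurable_fun Omega g).
Hypotheses (C1u : C1_closure Omega u) (mfu : measurable_fun setT u).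
Hypothesis sub_u : weak_subsolution s Omega c g u.
Hypothesis u_le0 : forall x, ~ Omega x -> u x <= 0.
Hypotheses (M0 : 0 <= M) (N0 : 0 <= N) (S0 : 0 <= S).
Hypothesis cM : {ae mu, forall x, Omega x -> `|c x| <= M}.
Hypothesis gN : {ae mu, forall x, Omega x -> `|g x| <= N}.
Hypothesis uS : {ae mu, forall x, Omega x -> u x <= S}.

Definition truncation (k : R) (m : nat) x := pos_above k (u x) ^+ m.

Lemma truncation_ge0 k m x : 0 <= truncation k m x.
Proof. by rewrite exprn_ge0// pos_above_ge0. Qed.

Lemma integrable_truncation k m : 0 < k ->
  mu.-integrable setT (EFin \o truncation k m.+2).
Proof.
by move=> k0; exact: integrable_C1c (C1c_pos_above oO bO C1u m k0 u_le0).1.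
Qed.

(** Both factors of the numerator have the same sign, because the truncation is a nondecreasing
    function of [u]. No convergence has to be checked: an infinite integral has real value 0 by
    convention, still nonnegative. *)
Lemma nonlocal_term_ge0 k : 0 <= \int[mu]_x (\int[mu]_y
  ((u x - u y) * (truncation k 3 x - truncation k 3 y) / enorm (x - y) `^
    (n%:R + 2 * s))).
Proof.
apply: Rintegral_ge0 => x _; apply: Rintegral_ge0 => y _.
apply: divr_ge0; last exact: powR_ge0.
have mono a b : a <= b -> pos_above k a ^+ 3 <= pos_above k b ^+ 3.
  move=> ab; apply: lerXn2r; rewrite ?nnegrE ?pos_above_ge0//.
  by rewrite ge_max; apply/andP; split; rewrite le_max ?lexx ?orbT// lerD2r ab.
rewrite /truncation; case: (leP (u x) (u y)) => [xy|/ltW yx].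
  by rewrite mulr_le0// subr_le0// mono.
by rewrite mulr_ge0// subr_ge0// mono.
Qed.

Lemma energy_estimate k : 0 < k ->
  (dirichlet (truncation k 2) <=
   (4 / 3 * (N + M * S) * \int[mu]_x truncation k 3 x)%:E)%E.
Proof.
move=> k0.
have mO : measurable Omega by exact: open_measurable_rV.
have [C1G gG] := C1c_pos_above oO bO C1u 0 k0 u_le0.
have [C1F gF] := C1c_pos_above oO bO C1u 1 k0 u_le0.
rewrite -/(truncation k 2) in C1G gG; rewrite -/(truncation k 3) in C1F gF.
(* The weak inequality is stated for every weak gradient; the classical one is inserted. *)
have wDu := C1_closure_weak_gradient oO bO C1u mfu.
have [_ _ /(_ _ wDu _ C1F (truncation_ge0 k 3))] := sub_u.
have NL := nonlocal_term_ge0 k.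
have mF : measurable_fun setT (truncation k 3) := C1c_measurable C1F.
have mFO : measurable_fun Omega (truncation k 3) by exact: measurable_funTS.
have muO : measurable_fun Omega u by exact: measurable_funTS.
have iF := integrable_truncation 1 k0.
pose I3 := \int[mu]_x truncation k 3 x.
(* The bound on [f] is asked only where the truncation is positive: there [u > k > 0], so that
   [u <= S] gives [|u| <= S]. *)
have bound (f : 'rV[R]_n -> R) (C : R) : 0 <= C -> measurable_fun Omega f ->
    {ae mu, forall x, Omega x -> 0 < truncation k 3 x -> `|f x| <= C} ->
    `|\int[mu]_(x in Omega) (f x * truncation k 3 x)| <= C * I3.
  move=> C0 mf fC; rewrite Rintegral_mkcond -RintegralZl//.
  apply: ae_le_Rintegral.
  - by apply/(measurable_restrictT _ mO); exact: measurable_funM.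
  - by have := integrableZl measurableT C iF; apply: eq_integrable.
  - by move=> x; rewrite mulr_ge0// truncation_ge0.
  - apply: filterS fC => x fCx; rewrite patchE; case: ifPn => [|_]; last first.
      by rewrite normr0 mulr_ge0// truncation_ge0.
    rewrite inE => Ox; rewrite normrM (ger0_norm (truncation_ge0 _ _ _)).
    have := truncation_ge0 k 3 x; rewrite le_eqVlt => /predU1P[<-|F0].
      by rewrite !mulr0.
    by rewrite ler_wpM2r ?truncation_ge0// fCx.
have gb : \int[mu]_(x in Omega) (g x * truncation k 3 x) <= N * I3.
  apply: le_trans (ler_norm _) _; apply: bound => //.
  by apply: filterS gN => x gx Ox _; exact: gx.
have cb : - (M * S * I3) <= \int[mu]_(x in Omega)
  (c x * u x * truncation k 3 x).
  have : `|\int[mu]_(x in Omega) (c x * u x * truncation k 3 x)| <= M * S * I3.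
    apply: bound; [exact: mulr_ge0|exact: measurable_funM|].
    apply: filterS2 cM uS => x cx ux Ox F0.
    rewrite normrM ler_pM ?cx//.
    have ku : k < u x.
      rewrite ltNge; apply/negP => uk; move: F0.
      rewrite /truncation (_ : pos_above _ _ = 0) ?expr0n ?ltxx//.
      by apply/max_idPr; rewrite subr_le0.
    by rewrite ger0_norm ?ux// (le_trans (ltW k0))// ltW.
  by rewrite ler_norml => /andP[].
pose q x := \sum_i grad (truncation k 2) x ord0 i ^+ 2.
have iGi i : mu.-integrable setT
  (fun x => (grad (truncation k 2) x ord0 i ^+ 2)%:E).
  have [C C0 gC] := C1c_grad_bounded C1G.
  have [r r0 Gr] := C1c_supp_radius C1G.
  apply: (@integrable_bounded _ _ (fun x => grad (truncation k 2) x ord0 i ^+ 2)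
    r (C ^+ 2)).
  - by apply: measurable_funX; exact: C1c_grad_measurable C1G i.
  - by move=> x; rewrite normrX ler_sqr ?nnegrE// ltW.
  - by move=> x /Gr[_ ->]; rewrite mxE expr0n.
have Dq : dirichlet (truncation k 2) = (\int[mu]_x (q x)%:E)%E.
  rewrite /dirichlet -integral_sum//.
  by apply: eq_integral => x _; rewrite sumEFin.
have iq : mu.-integrable setT (EFin \o q).
  have := @integrable_sum _ _ _ mu setT measurableT _ (index_enum 'I_n) xpredT
    (fun i x => (grad (truncation k 2) x ord0 i ^+ 2)%:E) (fun i _ => iGi i).
  by apply: eq_integrable => // x _; rewrite /= sumEFin.
(* With [P = (u - k)^+], [D(P^3) = 3 P^2 Du] and [D(P^2) = 2 P Du], so [Du . D(P^3) = 3 P^2 |Du|^2]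
   is [3/4] of [|D(P^2)|^2]. *)
have E : \int[mu]_(x in Omega) dotv (grad u x) (grad (truncation k 3) x) =
    3 / 4 * \int[mu]_x q x.
  rewrite Rintegral_mkcond -RintegralZl//; apply: eq_Rintegral => x _.
  rewrite patchE; case: ifPn => [|/negP]; rewrite inE => Ox.
    rewrite /dotv /q mulr_sumr; apply: eq_bigr => i _.
    by rewrite gG// gF//; field.
  have [_ _ _ KO] := C1G.
  rewrite [LHS](_ : _ = 0)// /q big1 ?mulr0// => i _.
  by rewrite (grad_near0 (closure_support_near0 (contra_not (KO x) Ox))) mxE
    expr0n.
rewrite E Dq => ineq.
rewrite -(@fineK _ (\int[mu]_x (q x)%:E)%E); last exact: integrable_fin_num.
rewrite lee_fin -/(Rintegral mu setT q) -/I3.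
lra.
Qed.

(** * Superlevel sets and one step of their decay *)

Definition superlevel (k : R) : set 'rV[R]_n := [set x | k < u x].

Lemma measurable_superlevel k : measurable (superlevel k).
Proof.
have -> : superlevel k = setT `&` u @^-1` `]k, +oo[%classic.
  by rewrite setTI; apply/seteqP; split => x;
    rewrite /superlevel /= in_itv/= andbT.
exact: mfu.
Qed.

Lemma integrable_superlevel k : 0 < k ->
  mu.-integrable setT (EFin \o \1_(superlevel k)).
Proof.
move=> k0; have [r [_ Or]] := bO.
apply: (@integrable_bounded _ _ _ (`|r| + 1) 1).
- by apply: measurable_indic; exact: measurable_superlevel.
- by move=> x; rewrite indicE; case: (_ \in _); rewrite ?normr1 ?normr0.
- move=> x rx; rewrite indicE memNset// => kx.
  have Ox : Omega x.
    by apply: contrapT => /u_le0; apply/negP; rewrite -ltNge (lt_trans k0).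
  have r1 : r < `|r| + 1 by rewrite (le_lt_trans (ler_norm _))// ltrDl.
  by have /(lt_le_trans rx) := Or _ r1 x Ox; rewrite ltxx.
Qed.

Lemma Rintegral_superlevel k : 0 < k ->
  (\int[mu]_x \1_(superlevel k) x)%:E = mu (superlevel k).
Proof.
move=> k0; rewrite fineK.
  rewrite (integral_indic _ measurableT) ?setIT//; exact: measurable_superlevel.
exact: integrable_fin_num (integrable_superlevel k0).
Qed.

Lemma superlevel_step k r A V : (0 < n)%N -> 0 < k -> 0 < r -> 0 < A ->
  N + M * S <= A -> (mu (superlevel k) <= V%:E)%E -> V <= (2 * r) ^+ n / 2 ->
  (mu (superlevel (k + 4 * (3 * n%:R * r ^+ 2 * A))) <= (V / 2)%:E)%E.
Proof.
move=> n0 k0 r0 A0 NMS kV Vr.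
(* Faber-Krahn and the energy estimate produce the factor [2 * 4/3 = 8/3], rounded up to 3. As
   [A > 0], [D] is positive and can be divided by. *)
set D := 3 * n%:R * r ^+ 2 * A.
have D0 : 0 < D by rewrite !mulr_gt0// ?ltr0n// exprn_gt0.
have [C1G _] := C1c_pos_above oO bO C1u 0 k0 u_le0.
rewrite -/(truncation k 2) in C1G.
have P_eq0 x : u x <= k -> pos_above k (u x) = 0.
  by move=> ux; apply/max_idPr; rewrite subr_le0.
have P_gt x : k < u x -> pos_above k (u x) = u x - k.
  by move=> ux; apply/max_idPl; rewrite subr_ge0 ltW.
have supG : [set x | truncation k 2 x != 0] = superlevel k.
  apply/seteqP; split => x; rewrite /superlevel/= /truncation.
    by apply: contraNT; rewrite -leNgt => /P_eq0 ->; rewrite expr0n.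
  by move=> kx; rewrite P_gt// gt_eqF// exprn_gt0// subr_gt0.
pose I3 := \int[mu]_x truncation k 3 x.
pose I4 := \int[mu]_x truncation k 4 x.
have i3 := integrable_truncation 1 k0.
have i4 := integrable_truncation 2 k0.
have ik := integrable_superlevel k0.
have I4D : I4 <= D * I3.
  have := @faber_krahn _ _ _ _ C1G r r0; rewrite supG => /(_ (le_trans kV _)).
  rewrite lee_fin => /(_ Vr) fk.
  have nr0 : 0 <= n%:R * r ^+ 2 :> R by rewrite mulr_ge0// sqr_ge0.
  have c0 : 0 <= 2 * (n%:R * r ^+ 2) :> R by rewrite mulr_ge0.
  have c0' : (0 <= (2 * (n%:R * r ^+ 2))%:E :> \bar R)%E by rewrite lee_fin.
  have := le_trans fk (lee_wpmul2l c0' (energy_estimate k0)).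
  have -> : (\int[mu]_x (truncation k 2 x ^+ 2)%:E)%E = I4%:E.
    rewrite fineK; last exact: integrable_fin_num i4.
    by apply: eq_integral => x _; rewrite /truncation -exprM.
  rewrite -EFinM lee_fin -/I3 => /le_trans; apply.
  have I30 : 0 <= I3 by apply: Rintegral_ge0 => x _; exact: truncation_ge0.
  have rn : 0 <= n%:R * r ^+ 2 * I3 :> R by rewrite mulr_ge0.
  have := ler_wpM2l rn NMS.
  have : 0 <= n%:R * r ^+ 2 * I3 * A by rewrite mulr_ge0// ltW.
  have -> : D * I3 = 3 * (n%:R * r ^+ 2 * I3 * A) by rewrite /D; ring.
  have -> : 2 * (n%:R * r ^+ 2) * (4 / 3 * (N + M * S) * I3) =
    8 / 3 * (n%:R * r ^+ 2 * I3 * (N + M * S)) by field.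
  move: (n%:R * r ^+ 2 * I3 * A) (n%:R * r ^+ 2 * I3 * (N + M * S)) => a b; lra.
(* [t^3 <= t^4 / (2 D) + (2 D)^3] for [t >= 0] plays the role of Hoelder. *)
have I3V : I3 <= (2 * D)^-1 * I4 + (2 * D) ^+ 3 * V.
  have muV : \int[mu]_x \1_(superlevel k) x <= V.
    by rewrite -lee_fin Rintegral_superlevel.
  have D30 : 0 <= (2 * D) ^+ 3 by rewrite exprn_ge0// mulr_ge0// ltW.
  apply: le_trans (lerD (lexx _) (ler_wpM2l D30 muV)).
  rewrite -!RintegralZl// -RintegralD//; last 2 first.
  - by have := integrableZl measurableT (2 * D)^-1 i4; apply: eq_integrable.
  - by have := integrableZl measurableT ((2 * D) ^+ 3) ik; apply: eq_integrable.
  apply: le_Rintegral => //.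
    have := integrableD measurableT (integrableZl measurableT (2 * D)^-1 i4)
      (integrableZl measurableT ((2 * D) ^+ 3) ik).
    by apply: eq_integrable.
  move=> x _; rewrite /truncation indicE.
  have [kx|xk] := ltP k (u x); last by rewrite P_eq0// !expr0n/= mulr0 add0r
    mulr_ge0.
  rewrite mem_set// mulr1 P_gt//.
  have : 0 < u x - k by rewrite subr_gt0.
  set t := u x - k => t0; have [tD|tD] := leP (2 * D) t.
    apply: (@le_trans _ _ ((2 * D)^-1 * t ^+ 4)); last by rewrite lerDl.
    have D20 : 0 < 2 * D by rewrite mulr_gt0.
    rewrite [X in _ <= X]mulrC (ler_pdivlMr _ _ D20) [X in _ <= X]exprSr.
    by rewrite ler_wpM2l// exprn_ge0// ltW.
  apply: (@le_trans _ _ ((2 * D) ^+ 3)).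
    have D20 : 0 <= 2 * D by rewrite mulr_ge0// ltW.
    apply: lerXn2r; [exact: ltW t0|exact: D20|exact: ltW tD].
  by rewrite lerDr mulr_ge0 ?invr_ge0 ?mulr_ge0 ?exprn_ge0// ltW.
(* The two preceding bounds give [I4 <= I4 / 2 + 8 D^4 V], and the term [I4 / 2] is absorbed. *)
have I4V : I4 <= 16 * D ^+ 4 * V.
  have := le_trans I4D (ler_wpM2l (ltW D0) I3V).
  have -> : D * ((2 * D)^-1 * I4 + (2 * D) ^+ 3 * V) =
    I4 / 2 + 8 * (D ^+ 4 * V).
    by field; rewrite gt_eqF.
  have -> : 16 * D ^+ 4 * V = 16 * (D ^+ 4 * V) by ring.
  move: (D ^+ 4 * V) => a; lra.
have k40 : 0 < k + 4 * D by rewrite addr_gt0// mulr_gt0.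
have cheb : (4 * D) ^+ 4 * \int[mu]_x \1_(superlevel (k + 4 * D)) x <= I4.
  have i' := integrable_superlevel k40.
  rewrite -RintegralZl//; apply: le_Rintegral => //.
    by have := integrableZl measurableT ((4 * D) ^+ 4) i'; apply: eq_integrable.
  move=> x _; rewrite indicE.
  have [kx|xk] := pselect (superlevel (k + 4 * D) x); last first.
    by rewrite memNset// mulr0 truncation_ge0.
  rewrite mem_set// mulr1; apply: lerXn2r; rewrite ?nnegrE ?pos_above_ge0//.
    by rewrite mulr_ge0// ltW.
  by rewrite le_max lerBrDl (ltW kx).
(* Since [(4 D)^4 = 256 D^4], the measure is in fact at most [V / 16]; halving is all that the
   iteration uses. *)
rewrite -Rintegral_superlevel// lee_fin.
have V0 : 0 <= V by rewrite -lee_fin (le_trans _ kV).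
have D40 : 0 < 256 * D ^+ 4 by rewrite mulr_gt0// exprn_gt0.
rewrite -(ler_pM2l D40).
have -> : 256 * D ^+ 4 = (4 * D) ^+ 4 by ring.
apply: le_trans cheb (le_trans I4V _).
have : 0 <= D ^+ 4 * V by rewrite mulr_ge0// exprn_ge0// ltW.
have -> : (4 * D) ^+ 4 * (V / 2) = 128 * (D ^+ 4 * V) by field.
lra.
Qed.

End small_domain.

(** * Iteration *)

(** Serves with [x = 1 / (2 n)] and exponent [n], where the lower bound is [1/2]. In the induction
    step the two sides differ by [m x^2]. *)
Lemma bernoulli_le (R : realDomainType) (x : R) (m : nat) :
  0 <= x <= 1 -> 1 - m%:R * x <= (1 - x) ^+ m.
Proof.
move=> /andP[x0 x1]; elim: m => [|m IH]; first by rewrite mul0r subr0 expr0.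
have x1' : 0 <= 1 - x by rewrite subr_ge0.
rewrite exprS; apply: le_trans (ler_wpM2l x1' IH).
have : 0 <= m%:R * (x * x) by rewrite !mulr_ge0.
rewrite -natr1; move: (m%:R : R) => a; rewrite -subr_ge0.
have -> : (1 - x) * (1 - a * x) - (1 - (a + 1) * x) = a * (x * x) by ring.
by [].
Qed.

Lemma lebesgue_superlevel_eq0 (R : realType) (n : nat) (s : R)
    (Omega : set 'rV[R]_n) (c g u : 'rV[R]_n -> R) (M N S k r A : R) :
  open Omega -> bounded_set Omega ->
  measurable_fun Omega c -> measurable_fun Omega g ->
  C1_closure Omega u -> measurable_fun setT u ->
  weak_subsolution s Omega c g u -> (forall x, ~ Omega x -> u x <= 0) ->
  0 <= M -> 0 <= N -> 0 <= S ->
  {ae lebesgue_rV n, forall x, Omega x -> `|c x| <= M} ->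
  {ae lebesgue_rV n, forall x, Omega x -> `|g x| <= N} ->
  {ae lebesgue_rV n, forall x, Omega x -> u x <= S} ->
  (0 < n)%N -> 0 < k -> 0 < r -> 0 < A -> N + M * S <= A ->
  (lebesgue_rV n (superlevel u k) <= ((2 * r) ^+ n / 2)%:E)%E ->
  lebesgue_rV n (superlevel u (k + 24 * n%:R ^+ 2 * r ^+ 2 * A)) = 0%E.
Proof.
move=> oO bO mc mg C1u mfu sub_u u_le0 M0 N0 S0 cM gN uS n0 k0 r0 A0 NMS kV.
have nR : 1 <= n%:R :> R by rewrite ler1n.
have nR0 : 0 < n%:R :> R by rewrite ltr0n.
(* The radii [r * t ^+ j] satisfy [(t ^+ n) ^+ j >= 2^-j], so that superlevel
   sets halved at each step stay admissible for [superlevel_step]. *)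
pose t : R := 1 - (2 * n%:R)^-1.
have h01 : 0 < (2 * n%:R)^-1 :> R by rewrite invr_gt0 mulr_gt0.
have h12 : (2 * n%:R)^-1 <= 2^-1 :> R.
  by rewrite lef_pV2 ?posrE ?mulr_gt0// ler_peMr.
have t0 : 0 < t by rewrite /t; lra.
have t1 : t <= 1 by rewrite /t; lra.
have tn : 2^-1 <= t ^+ n.
  apply: le_trans (bernoulli_le n _);
    last by rewrite (ltW h01) (le_trans h12)//; lra.
  have -> : n%:R * (2 * n%:R)^-1 = 2^-1 :> R by field; rewrite gt_eqF.
  lra.
(* Step [j] raises the level by [12 n r^2 t^(2j) A], at most [12 n r^2 A t^j]; the ratio satisfies
   [1 / (1 - t) = 2 n], so the geometric series sums to [L], and [kappa j] adds its first [j] terms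
   to [k]. *)
pose L := 24 * n%:R ^+ 2 * r ^+ 2 * A.
have L0 : 0 <= L by rewrite !mulr_ge0 ?exprn_ge0// ltW.
pose V := (2 * r) ^+ n / 2.
have V0 : 0 <= V by rewrite divr_ge0// exprn_ge0// mulr_ge0// ltW.
pose kappa j := k + L * (1 - t ^+ j).
have tj j : 0 < t ^+ j by rewrite exprn_gt0.
have tj1 j : t ^+ j <= 1 by rewrite exprn_ile1// ltW.
have kappa_ge j : k <= kappa j by rewrite lerDl mulr_ge0// subr_ge0.
have mono a b : a <= b -> (lebesgue_rV n (superlevel u b) <=
  lebesgue_rV n (superlevel u a))%E.
  move=> ab; apply: le_measure; rewrite ?inE//;
    try exact: measurable_superlevel.
  by move=> x; exact: le_lt_trans.
have decay j : (lebesgue_rV n (superlevel u (kappa j)) <= (V * 2^-1 ^+ j)%:E)%E.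
  elim: j => [|j IH]; first by rewrite /kappa !expr0 subrr mulr0 addr0 mulr1.
  have rj : 0 < r * t ^+ j by rewrite mulr_gt0.
  have Vj : V * 2^-1 ^+ j <= (2 * (r * t ^+ j)) ^+ n / 2.
    have -> : (2 * (r * t ^+ j)) ^+ n / 2 = V * (t ^+ n) ^+ j.
      by rewrite mulrA exprMn -exprM mulnC exprM /V mulrAC.
    by rewrite ler_wpM2l// lerXn2r// nnegrE ?invr_ge0// exprn_ge0// ltW.
  have := superlevel_step oO bO mc mg C1u mfu sub_u u_le0 M0 N0 S0 cM gN uS n0
    (lt_le_trans k0 (kappa_ge j)) rj A0 NMS IH Vj.
  rewrite [_ / 2](_ : _ = V * 2^-1 ^+ j.+1); last by rewrite exprSr mulrA.
  apply: le_trans; apply: mono.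
  rewrite /kappa -addrA lerD2l.
  have -> : L * (1 - t ^+ j.+1) = L * (1 - t ^+ j) + 4 *
    (3 * n%:R * r ^+ 2 * t ^+ j * A).
    by rewrite exprS /L /t; field; rewrite gt_eqF.
  rewrite lerD2l ler_wpM2l// ler_wpM2r ?(ltW A0)// exprMn mulrA.
  rewrite ler_wpM2l ?mulr_ge0 ?exprn_ge0 ?(ltW r0)//.
  by rewrite expr2 ler_piMl// ltW.
apply/eqP; rewrite eq_le measure_ge0 andbT.
(* The level [k + L] lies above every [kappa j], so the measure is below all the bounds [V / 2^j],
   which tend to 0. *)
apply: (@cvge_ge _ \oo _ R (fun j => (V * 2^-1 ^+ j)%:E) 0%E).
  apply: nearW => j; apply: le_trans (decay j); apply: mono.
  by rewrite /kappa lerD2l -/L ler_piMr// lerBlDr lerDl ltW.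
apply: cvg_EFin; first exact: nearW.
have := @cvg_geometric R V 2^-1; apply.
by rewrite ger0_norm ?invr_ge0//; lra.
Qed.

(** * Choice of the constants and absorption *)

Theorem lemma2p13 (R : realType) (n : nat) (M : R) (n_ge2 : (2 <= n)%N) :
  exists delta K : R, 0 < delta /\ 0 < K /\
  forall (s : R) (Omega : set 'rV[R]_n) (c g u : 'rV[R]_n -> R),
    0 < s < 1 ->
    bounded_lipschitz_domain Omega ->
    Linfty Omega c -> Linfty_norm Omega c = M%:E ->
    Linfty Omega g ->
    C1_closure Omega u -> tail_space s u ->
    weak_subsolution s Omega c g u ->
    (forall x, ~ Omega x -> u x <= 0) ->
    (lebesgue_rV n Omega <= delta%:E)%E ->
    (Linfty_norm Omega (u^\+)%R <= K%:E * Linfty_norm Omega g)%E.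
Proof.
have n0 : (0 < n)%N by exact: leq_trans n_ge2.
have nR0 : 0 < n%:R :> R by rewrite ltr0n.
have a0 : 0 < `|M| + 1 by rewrite ltr_wpDl.
(* This makes [24 n^2 r^2 = 0.24 / (|M| + 1)^2], so that the rise of the level stays below
   [(S + N) / 4] for the [A] chosen later. The absolute value keeps [r] positive before [M] is known
   to be a norm. *)
pose r := (10 * n%:R * (`|M| + 1))^-1.
have r0 : 0 < r by rewrite invr_gt0 !mulr_gt0.
(* [delta] is half the volume of the cube of half side [r], as Faber-Krahn requires. The final
   inequality [S <= S / 2 + N / 4] gives [S <= N / 2], so [K = 1] suffices. *)
exists ((2 * r) ^+ n / 2), 1; split;
  first by rewrite divr_gt0// exprn_gt0// mulr_gt0.
split => // s Omega c g u _ [oO _ _ bO _] [mc _] cM [mg gfin] C1u [[mfu _] _]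
  sub_u u_le0 Omega_small.
have M0 : 0 <= M by rewrite -lee_fin -cM; exact: Linfty_norm_ge0.
have [N gN] : exists N : R, Linfty_norm Omega g = N%:E.
  exists (fine (Linfty_norm Omega g)); rewrite fineK// ge0_fin_numE//.
  exact: Linfty_norm_ge0.
have N0 : 0 <= N by rewrite -lee_fin -gN; exact: Linfty_norm_ge0.
have [C C0 uC] := C1_closure_bounded bO C1u.
(* Absorption needs a finite [S]; [u] is bounded on [Omega], being continuous on the compact
   closure. *)
have [S uS] : exists S : R, Linfty_norm Omega (u^\+)%R = S%:E.
  exists (fine (Linfty_norm Omega (u^\+)%R));
    rewrite fineK// ge0_fin_numE ?Linfty_norm_ge0//.
  apply: (@le_lt_trans _ _ C%:E); last exact: ltry.
  apply/(Linfty_norm_ae _ _ (ltW C0)); apply: aeW => x Ox.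
  rewrite /funrpos ger0_norm ?le_max ?lexx ?orbT// ge_max (ltW C0) andbT.
  exact: le_trans (ler_norm _) (uC _ Ox).
have S0 : 0 <= S by rewrite -lee_fin -uS; exact: Linfty_norm_ge0.
rewrite uS gN mul1e lee_fin.
(* The iteration starts at the level [S / 4], which has to be positive. *)
have [->|S_neq0] := eqVneq S 0; first exact: N0.
have S_gt0 : 0 < S by rewrite lt_neqAle eq_sym S_neq0.
have cM' : {ae lebesgue_rV n, forall x, Omega x -> `|c x| <= M}.
  by apply/(Linfty_norm_ae _ _ M0); rewrite cM.
have gN' : {ae lebesgue_rV n, forall x, Omega x -> `|g x| <= N}.
  by apply/(Linfty_norm_ae _ _ N0); rewrite gN.
have uS' : {ae lebesgue_rV n, forall x, Omega x -> u x <= S}.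
  have : {ae lebesgue_rV n, forall x, Omega x -> `|(u^\+)%R x| <= S}.
    by apply/(Linfty_norm_ae _ _ S0); rewrite uS.
  apply: filterS => x + Ox => /(_ Ox); apply: le_trans.
  by rewrite /funrpos ger0_norm le_max ?lexx ?orbT.
(* Taking [M + 1] instead of [M] keeps [A] positive even when [M] and [N] are both 0. *)
pose A := N + (M + 1) * S.
have A0 : 0 < A by rewrite ltr_wpDl// mulr_gt0// ltr_wpDl.
have NMS : N + M * S <= A by rewrite /A lerD2l ler_wpM2r// lerDl.
have k0 : 0 < S / 4 by rewrite divr_gt0.
have kV : (lebesgue_rV n (superlevel u (S / 4)) <= ((2 * r) ^+ n / 2)%:E)%E.
  apply: le_trans Omega_small; apply: le_measure; rewrite ?inE//.
  - exact: measurable_superlevel.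
  - exact: open_measurable_rV.
  - move=> x kx; apply: contrapT => /u_le0; apply/negP; rewrite -ltNge.
    exact: lt_trans k0 kx.
have := lebesgue_superlevel_eq0 oO bO mc mg C1u mfu sub_u u_le0 M0 N0 S0 cM' gN'
  uS'
  n0 k0 r0 A0 NMS kV.
set k := S / 4 + _ => mu_k0.
have kS : k <= S / 2 + N / 4.
  have ME : `|M| = M by rewrite ger0_norm.
  have b0 : 0 < (M + 1)^-1 by rewrite invr_gt0 -ME.
  have b1 : (M + 1)^-1 <= 1 by rewrite invf_le1 ?lerDr// -ME.
  have -> : k = S / 4 + 24 / 100 * ((M + 1)^-1 ^+ 2 * N) + 24 / 100 *
    ((M + 1)^-1 * S).
    rewrite /k /A /r ME; field.
    by rewrite !gt_eqF// ltr_wpDl.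
  have bN : (M + 1)^-1 ^+ 2 * N <= N by rewrite ler_piMl// exprn_ile1// ltW.
  have bS : (M + 1)^-1 * S <= S by rewrite ler_piMl.
  move: ((M + 1)^-1 ^+ 2 * N) ((M + 1)^-1 * S) bN bS => ? ?; lra.
have T0 : 0 <= S / 2 + N / 4 by rewrite addr_ge0// divr_ge0.
suff ST : S <= S / 2 + N / 4 by clear -ST N0; lra.
rewrite -lee_fin -uS; apply/(Linfty_norm_ae _ _ T0).
(* The exceptional null set is the superlevel set at the limit level. *)
exists (superlevel u k); split => //; first exact: measurable_superlevel.
move=> x /= nx; rewrite /superlevel/= ltNge; apply/negP => ux; apply: nx => Ox.
rewrite /funrpos ger0_norm ?le_max ?lexx ?orbT// ge_max T0 andbT.
exact: le_trans ux kS.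
Qed.
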